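(* Let $L$ be a valid lattice and $K$ a Kasteleyn matrix for $\mathbb{T}_L$. Let $\varphi\in\mathscr{F}(L)$ and let $c_{ij}\,q_0^iq_1^j$ be the monomial in the full expansion of the Laurent polynomial $\det(K)$ that corresponds to $\varphi$. Then $|c_{ij}|$ is the number of tilings of $\mathbb{T}_L$ with flux $\varphi$.
   Context: Tilings: the unit square $[i,i+1]\times[j,j+1]$ ($i,j\in\mathbb{Z}$) is black if $i+j$ is even and white otherwise. A domino is the union of two unit squares sharing a side; a tiling of $\mathbb{Z}^2$ is a set of dominoes with pairwise disjoint interiors covering $\mathbb{R}^2$. Let $\mathscr{E}=2\mathbb{Z}^2$, $\mathscr{O}=2\mathbb{Z}^2+(1,1)$. A valid lattice is a subgroup $L\subset\mathbb{Z}^2$ generated by two linearly independent vectors in $\mathscr{E}\sqcup\mathscr{O}$. A tiling of $\mathbb{T}_L=\mathbb{R}^2/L$ is identified with an $L$-periodic tiling of $\mathbb{Z}^2$. Height functions and flux: each unit edge between neighboring points of $\mathbb{Z}^2$ is oriented so that the boundary of every black square is oriented clockwise. The height function $h_t:\mathbb{Z}^2\to\mathbb{Z}$ of a tiling $t$ satisfies $h_t(0)=0$ and, for every edge oriented from $u$ to $w$: $h_t(w)=h_t(u)+1$ if the edge is not the common side of the two squares of a domino of $t$, and $h_t(w)=h_t(u)-3$ otherwise. For a tiling $t$ of $\mathbb{T}_L$, the flux is the unique $\varphi_t\in\mathbb{R}^2$ with $4\langle\varphi_t,v\rangle=h_t(u+v)-h_t(u)$ for all $v\in L$, $u\in\mathbb{Z}^2$.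 $\mathscr{F}(L)$ is the set of fluxes of all tilings of $\mathbb{T}_L$. Kasteleyn matrix: let $x_0$ be the smallest positive integer with $v_0=(x_0,0)\in L$, $y_1$ the smallest positive integer such that $L$ contains a vector with second coordinate $y_1$, and $v_1=(x_1,y_1)$ the unique such vector in $L$ with $0\le x_1<x_0$; $\{v_0,v_1\}$ generates $L$. The rectangle $D_L=[0,x_0]\times[0,y_1]$ is a fundamental domain with equally many black and white squares; enumerate its black squares $b_1,\dots,b_m$ and its white squares $w_1,\dots,w_m$ (arbitrarily). Let $G(\mathbb{Z}^2)$ be the graph whose vertices are the centers of unit squares, with edges joining centers of squares sharing a side (edges correspond to dominoes). An edge has sign $-1$ if it is horizontal with black left endpoint and white right endpoint, and sign $+1$ otherwise. Let $u(0)$ be the straight lattice path from $(0,0)$ to $v_0$ and $u(1)$ the lattice path $(0,0)\to(0,y_1)\to(x_1,y_1)$. To each $L$-orbit $[e]_L$ of edges of $G(\mathbb{Z}^2)$ assign the weight: its sign, multiplied for each $k\in\{0,1\}$ by $q_k$ if some edge in $[e]_L$ crosses $u(k)$ with its black endpoint to the left of the oriented path $u(k)$ (equivalently, a domino at that place produces a height change $+3$ along $u(k)$), by $q_k^{-1}$ if some edge in $[e]_L$ crosses $u(k)$ with its black endpoint to the right (height change $-3$), and by $1$ if no edge of $[e]_L$ crosses $u(k)$. The entry $K(i,j)$ is the sum of the weights of the $L$-orbits of edges joining a translate of $b_i$ to a translate of $w_j$ by elements of $L$ (0 if there are none). Thus $\det K$ is a Laurent polynomial in $q_0,q_1$. Correspondence: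 the monomial corresponding to $\varphi\in\mathscr{F}(L)$ is $q_0^iq_1^j$ with $i=\langle\varphi,v_0\rangle$, and $j=\langle\varphi,v_1\rangle$ if $v_1\in\mathscr{E}$, $j=\langle\varphi,v_1\rangle-\frac12$ if $v_1\in\mathscr{O}$. *)

(* Defs.v *)
From HB Require Import structures.
From mathcomp Require Import all_boot all_order all_algebra finmap.
From mathcomp Require Import boolp classical_sets functions cardinality fsbigop.
From mathcomp Require Import reals.
From mathcomp.multinomials Require Import monalg.

Set Implicit Arguments.
Unset Strict Implicit.
Unset Printing Implicit Defensive.

Import GRing.Theory Num.Theory.

Local Open Scope ring_scope.
Local Open Scope classical_set_scope.

(** * Integer Laurent polynomials in two variables

    The element [<< c *g (i, j) >>] is the monomial c q_0^i q_1^j, and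
    [p@_(i, j)] is the coefficient of q_0^i q_1^j in p.  The library gives
    [{malg int[K]}] a product only when the monoid K has no nontrivial unit, so
    the convolution product for the group K = Z^2 is defined here. *)

Definition laurent : Type := {malg int[(int * int)%type]}.

HB.instance Definition _ := GRing.Zmodule.on laurent.

Section LaurentRing.

Implicit Types (p q r : laurent) (k : (int * int)%type) (c : int).

Definition lone : laurent := << 1 *g (0 : (int * int)%type) >>.

Definition lmul p q : laurent :=
  \sum_(k <- msupp p) \sum_(l <- msupp q) << p@_k * q@_l *g k + l >>.

Lemma lmulw (d1 d2 : {fset (int * int)%type}) p q :
  (msupp p `<=` d1)%fset -> (msupp q `<=` d2)%fset ->
  lmul p q = \sum_(k <- d1) \sum_(l <- d2) << p@_k * q@_l *g k + l >>.
Proof.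
move=> le1 le2; rewrite /lmul (big_fset_incl _ le1) /=; last first.
  by move=> k _ /mcoeff_outdom ->; rewrite big1 // => l _; rewrite mul0r monalgU0.
apply: eq_bigr => k _; rewrite (big_fset_incl _ le2) //= => l _.
by move/mcoeff_outdom ->; rewrite mulr0 monalgU0.
Qed.

Lemma lmulC : commutative lmul.
Proof.
move=> p q; rewrite /lmul exchange_big /=; apply: eq_bigr => l _.
by apply: eq_bigr => k _; rewrite mulrC addrC.
Qed.

Lemma lmul0 q : lmul 0 q = 0.
Proof. by rewrite /lmul msupp0 big_seq_fset0. Qed.

Lemma lmulDl : left_distributive lmul +%R.
Proof.
move=> p q r.
have le := fsubset_refl (msupp r).
rewrite (lmulw (fsubsetUl (msupp p) (msupp q)) le).
rewrite (lmulw (fsubsetUr (msupp p) (msupp q)) le).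
rewrite (lmulw (msuppD_le p q) le) -big_split /=; apply: eq_bigr => k _.
rewrite -big_split /=; apply: eq_bigr => l _.
by rewrite mcoeffD mulrDl monalgUD.
Qed.

Lemma lmulUU c1 c2 k1 k2 :
  lmul << c1 *g k1 >> << c2 *g k2 >> = << c1 * c2 *g k1 + k2 >>.
Proof. by rewrite (lmulw msuppU_le msuppU_le) !big_seq_fset1 !mcoeffUU. Qed.

Lemma lmulDr : right_distributive lmul +%R.
Proof. by move=> p q r; rewrite lmulC lmulDl !(lmulC _ p). Qed.

Lemma lmul_suml (I : Type) (s : seq I) (F : I -> laurent) q :
  lmul (\sum_(i <- s) F i) q = \sum_(i <- s) lmul (F i) q.
Proof. exact: (big_morph (lmul^~ q) (fun _ _ => lmulDl _ _ _) (lmul0 q)). Qed.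

Lemma laurentE p : p = \sum_(k <- msupp p) << p@_k *g k >>.
Proof. exact: monalgE. Qed.

Lemma lmul_sumr (I : Type) (s : seq I) (F : I -> laurent) p :
  lmul p (\sum_(i <- s) F i) = \sum_(i <- s) lmul p (F i).
Proof. by rewrite lmulC lmul_suml; apply: eq_bigr => i _; rewrite lmulC. Qed.

Lemma lmulA : associative lmul.
Proof.
move=> p q r.
rewrite (laurentE p) (lmul_suml _ _ (lmul q r)) (lmul_suml _ _ q) (lmul_suml _ _ r).
apply: eq_bigr => k _.
rewrite (laurentE q) (lmul_suml _ _ r) !(lmul_sumr _ _ << _ *g k >>) (lmul_suml _ _ r).
apply: eq_bigr => l _.
rewrite (laurentE r) (lmul_sumr _ _ << _ *g l >>) (lmul_sumr _ _ << _ *g k >>).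
rewrite (lmul_sumr _ _ (lmul _ _)); apply: eq_bigr => n _.
by rewrite !lmulUU mulrA addrA.
Qed.

Lemma lmul1 : left_id lone lmul.
Proof.
move=> p; rewrite (laurentE p) lmul_sumr; apply: eq_bigr => k _.
by rewrite lmulUU mul1r add0r.
Qed.

Lemma lone_neq0 : lone != 0.
Proof. by apply/eqP => /malgP /(_ 0); rewrite mcoeffUU mcoeff0. Qed.

HB.instance Definition _ := GRing.Zmodule_isComNzRing.Build laurent
  lmulA lmulC lmul1 lmulDl lone_neq0.

End LaurentRing.

(** * Squares, dominoes and tilings *)

Notation pointZ := (int * int)%type.

(** The unit square [i, i+1] x [j, j+1] is named by its corner (i, j). *)
Notation square := (int * int)%type (only parsing).

Definition black (s : square) : bool := (2 %| s.1 + s.2)%Z.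

Definition share_side (s s' : square) : bool :=
  `|s.1 - s'.1| + `|s.2 - s'.2| == 1.

(** A domino, or equivalently an edge of the graph of square centers, is given
    by its black square followed by its white square. *)
Notation edge := (square * square)%type.

Definition is_edge (e : edge) : bool :=
  [&& black e.1, ~~ black e.2 & share_side e.1 e.2].

Definition in_domino (s : square) (e : edge) : bool := (s == e.1) || (s == e.2).

(** Dominoes are unions of unit squares, so two of them have disjoint interiors
    exactly when they have no square in common. *)
Definition is_tiling (t : set edge) : Prop :=
  [/\ forall e, t e -> is_edge e,
      forall e e' s, t e -> t e' -> in_domino s e -> in_domino s e' -> e = e'
    & forall s, exists2 e, t e & in_domino s e].

(** * Valid lattices *)

Definition in_E (v : pointZ) : bool := (2 %| v.1)%Z && (2 %| v.2)%Z.

Definition in_O (v : pointZ) : bool := in_E (v - (1, 1)).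

Definition valid_lattice (L : set pointZ) : Prop :=
  exists v w : pointZ,
    [/\ in_E v || in_O v, in_E w || in_O w,
        forall a b : int, v *~ a + w *~ b = 0 -> a = 0 /\ b = 0
      & L = [set u | exists a b : int, u = v *~ a + w *~ b]].

Definition translate (e : edge) (v : pointZ) : edge := (e.1 + v, e.2 + v).

Definition torus_tiling (L : set pointZ) (t : set edge) : Prop :=
  is_tiling t /\ forall v, L v -> forall e, t e -> t (translate e v).

(** * Height functions and flux *)

Inductive direction := East | North | West | South.

Definition dvec (d : direction) : pointZ :=
  match d with
  | East => (1, 0) | North => (0, 1) | West => (-1, 0) | South => (0, -1)
  end.

(** A step (u, d) traverses the unit edge from u to u + dvec d. *)
Notation step := (pointZ * direction)%type.

Definition left_square (s : step) : square :=
  match s.2 with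
  | East => s.1 | North => s.1 - (1, 0)
  | West => s.1 - (1, 1) | South => s.1 - (0, 1)
  end.

Definition right_square (s : step) : square :=
  match s.2 with
  | East => s.1 - (0, 1) | North => s.1
  | West => s.1 - (1, 0) | South => s.1 - (1, 1)
  end.

(** The boundary of a square runs clockwise when the square lies on its right,
    so a unit edge is oriented along the step that has its black square on the
    right. *)
Definition is_height (t : set edge) (h : pointZ -> int) : Prop :=
  h 0 = 0 /\
  forall (u : pointZ) (d : direction), black (right_square (u, d)) ->
    let e := (right_square (u, d), left_square (u, d)) in
    (~ t e -> h (u + dvec d) = h u + 1) /\ (t e -> h (u + dvec d) = h u - 3).

Definition inner (R : realType) (phi : R * R) (v : pointZ) : R :=
  phi.1 * v.1%:~R + phi.2 * v.2%:~R.

Definition is_flux (R : realType) (L : set pointZ) (t : set edge)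
    (phi : R * R) : Prop :=
  exists2 h, is_height t h &
    forall v, L v -> forall u, 4 * inner phi v = (h (u + v) - h u)%:~R.

Definition fluxes (R : realType) (L : set pointZ) : set (R * R) :=
  [set phi | exists2 t, torus_tiling L t & is_flux L t phi].

(** * Kasteleyn matrices *)

(** v_0 = (x0, 0) and v_1 = (x1, y1). *)
Definition lattice_basis (L : set pointZ) (x0 x1 y1 : nat) : Prop :=
  [/\ (0 < x0)%N /\ L (x0%:Z, 0),
      forall x : nat, (0 < x)%N -> L (x%:Z, 0) -> (x0 <= x)%N,
      (0 < y1)%N /\ (exists x : int, L (x, y1%:Z)),
      forall y : nat, (0 < y)%N -> (exists x : int, L (x, y%:Z)) -> (y1 <= y)%N
    & (x1 < x0)%N /\ L (x1%:Z, y1%:Z)].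

Definition domain_squares (x0 y1 : nat) : set square :=
  [set s | (0 <= s.1 < x0%:Z) && (0 <= s.2 < y1%:Z)].

Definition path0 (x0 : nat) : seq step :=
  [seq ((i%:Z, 0), East) | i <- iota 0 x0].

Definition path1 (x1 y1 : nat) : seq step :=
  [seq ((0, j%:Z), North) | j <- iota 0 y1] ++
  [seq ((i%:Z, y1%:Z), East) | i <- iota 0 x1].

(** The edge crosses a step of p, its black square [e.1] lying to the left
    (resp. right) of p. *)
Definition crosses_black_left (p : seq step) (e : edge) : bool :=
  e \in [seq (left_square s, right_square s) | s <- p].

Definition crosses_black_right (p : seq step) (e : edge) : bool :=
  e \in [seq (right_square s, left_square s) | s <- p].

Definition negative_edge (e : edge) : bool := e.2 == e.1 + (1, 0).

Definition orbit (L : set pointZ) (e : edge) : set edge :=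
  [set e' | exists2 v, L v & e' = translate e v].

Definition meets (o : set edge) (P : pred edge) : bool := `[< exists2 e, o e & P e >].

(** Translation preserves signs, so an orbit is negative as soon as one of its
    edges is. *)
Definition orbit_sign (o : set edge) : int :=
  if meets o negative_edge then -1 else 1.

Definition q_exponent (p : seq step) (o : set edge) : int :=
  if meets o (crosses_black_left p) then 1
  else if meets o (crosses_black_right p) then -1
  else 0.

Definition orbit_weight (x0 x1 y1 : nat) (o : set edge) : laurent :=
  << orbit_sign o *g (q_exponent (path0 x0) o, q_exponent (path1 x1 y1) o) >>.

Definition joining_orbits (L : set pointZ) (b w : square) : set (set edge) :=
  [set o | exists e : edge,
     [/\ is_edge e, exists2 v, L v & e.1 = b + v,
         exists2 v, L v & e.2 = w + v & o = orbit L e]].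

Definition kasteleyn (L : set pointZ) (x0 x1 y1 m : nat)
    (b w : 'I_m -> square) : 'M[laurent]_m :=
  \matrix_(i, j)
    \sum_(o \in joining_orbits L (b i) (w j)) orbit_weight x0 x1 y1 o.

(** The monomial q_0^i q_1^j corresponds to the flux phi.  The half-integer shift
    is needed because heights are 0 mod 4 on 2Z^2 and 2 mod 4 on 2Z^2 + (1, 1). *)
Definition corresponds (R : realType) (x0 x1 y1 : nat) (phi : R * R)
    (i j : int) : Prop :=
  let v0 : pointZ := (x0%:Z, 0) in
  let v1 : pointZ := (x1%:Z, y1%:Z) in
  [/\ i%:~R = inner phi v0,
      in_E v1 -> j%:~R = inner phi v1
    & in_O v1 -> j%:~R = inner phi v1 - 2^-1].

(* Main.v *)
(** Every tiling is compared with the brick wall tiling, whose dominoes are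
    horizontal with the black square on the left.  Following a domino of the
    tiling and then a brick backwards permutes the black squares of the torus;
    the squares that start a brick of the tiling are fixed and carry the
    negative edges, so the sign of a term of [det K] is, up to a global constant,
    the parity of the number of cycles of moving squares.  These cycles are level lines of a
    quarter of the difference of the two height functions.  They only travel
    leftwards, and the level is monotone along columns, so a level line is
    connected in the plane and is determined by its level.  Hence the cycles
    on the torus correspond to the levels modulo the periods of the height
    difference, and their number depends on the flux alone: all the terms
    contributing to one monomial have the same sign. *)

From HB Require Import structures.
Require Import Defs.
From mathcomp Require Import all_boot all_order fingroup perm all_algebra zify ring lra.
From mathcomp Require Import boolp classical_sets functions cardinality fsbigop reals.
From mathcomp.multinomials Require Import monalg.

Set Implicit Arguments.
Unset Strict Implicit.
Unset Printing Implicit Defensive.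

Import Order.TTheory GRing.Theory Num.Theory.

Local Open Scope ring_scope.
Local Open Scope classical_set_scope.

(** * Directions and unit steps *)

Definition dir_code (d : direction) : bool * bool :=
  match d with
  | East => (true, true) | North => (false, true)
  | West => (true, false) | South => (false, false)
  end.

Definition dir_decode (c : bool * bool) : direction :=
  match c with
  | (true, true) => East | (false, true) => North
  | (true, false) => West | (false, false) => South
  end.

Lemma dir_codeK : cancel dir_code dir_decode.
Proof. by case. Qed.

(** Finiteness lets matrix entries and determinant terms be summed over directions. *)
HB.instance Definition _ := Finite.copy direction (can_type dir_codeK).

Definition dopp (d : direction) : direction :=
  match d with East => West | North => South | West => East | South => North end.

Lemma doppK : involutive dopp. Proof. by case. Qed.

Lemma dvec_opp d : dvec (dopp d) = - dvec d. Proof. by case: d. Qed.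

Lemma dvec_inj : injective dvec. Proof. by case; case. Qed.

Lemma share_sideP (p q : pointZ) : share_side p q -> exists d, q = p + dvec d.
Proof.
case: p q => [x y] [x' y']; rewrite /share_side /= => /eqP H.
have : (x' = x + 1 /\ y' = y) \/ (x' = x /\ y' = y + 1) \/
       (x' = x - 1 /\ y' = y) \/ (x' = x /\ y' = y - 1) by lia.
case=> [[-> ->]|[[-> ->]|[[-> ->]|[-> ->]]]];
  [exists East|exists North|exists West|exists South];
  by rewrite /dvec; congr (_, _); rewrite /= ?addr0.
Qed.

Lemma share_side_dvec (p : pointZ) d : share_side p (p + dvec d).
Proof. by case: p d => x y []; rewrite /share_side /=; apply/eqP; lia. Qed.

Lemma black_dvec (p : pointZ) d : black (p + dvec d) = ~~ black p.
Proof. by case: p d => x y []; rewrite /black /=; lia. Qed.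

Lemma blackB (p : pointZ) d : black (p - dvec d) = ~~ black p.
Proof. by rewrite -dvec_opp black_dvec. Qed.

Lemma addE x y : (x, y) + dvec East = (x + 1, y).
Proof. by congr (_, _); rewrite /= ?addr0. Qed.

Lemma addN x y : (x, y) + dvec North = (x, y + 1).
Proof. by congr (_, _); rewrite /= ?addr0. Qed.

(** * Functions on the grid and their increments *)

Lemma const_of_steps (T : Type) (k : pointZ -> T) :
  (forall u, k (u + dvec East) = k u) -> (forall u, k (u + dvec North) = k u) ->
  forall u, k u = k 0.
Proof.
move=> kE kN [x y].
have kx z : k (z, 0) = k 0.
  elim/int_rect: z => [|n IH|n IH]//.
    by rewrite -IH -(kE (n%:Z, 0)); congr (k (_, _)) => /=; lia.
  by rewrite -IH -kE; congr (k (_, _)) => /=; lia.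
elim/int_rect: y => [|n IH|n IH]//.
  by rewrite -IH -(kN (x, n%:Z)); congr (k (_, _)) => /=; lia.
by rewrite -IH -kN; congr (k (_, _)) => /=; lia.
Qed.

(** Discrete antiderivative vanishing at 0; the negative branch is set so that [primS] also holds
    across 0. *)
Definition prim (a : int -> int) (x : int) : int :=
  match x with
  | Posz n => \sum_(0 <= k < n) a k%:Z
  | Negz n => - \sum_(0 <= k < n.+1) a (- k.+1%:Z)
  end.

Lemma primS a x : prim a (x + 1) = prim a x + a x.
Proof.
case: x => n; first by rewrite -[Posz n + 1]/(Posz (n + 1)) addn1 /= big_nat_recr.
case: n => [|n].
  by rewrite -[Negz 0 + 1]/(Posz 0) /prim big_nat1 big_geq//= NegzE addrC subrr.
have -> : Negz n.+1 + 1 = Negz n by lia.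
rewrite /prim [in RHS]big_nat_recr//= NegzE opprD.
by rewrite -addrA addNr addr0.
Qed.

(** A closed discrete form is exact: integrate along the horizontal axis, then up the column. *)
Lemma potential_exists (a b : pointZ -> int) :
  (forall u, a u + b (u + dvec East) = b u + a (u + dvec North)) ->
  exists F : pointZ -> int, [/\ F 0 = 0,
    forall u, F (u + dvec East) = F u + a u &
    forall u, F (u + dvec North) = F u + b u].
Proof.
move=> ab; exists (fun u => prim (fun x => a (x, 0)) u.1 + prim (fun y => b (u.1, y)) u.2).
have FN (u : pointZ) : prim (fun x => a (x, 0)) (u + dvec North).1 +
    prim (fun y => b ((u + dvec North).1, y)) (u + dvec North).2 =
    prim (fun x => a (x, 0)) u.1 + prim (fun y => b (u.1, y)) u.2 + b u.
  by case: u => x y; rewrite /= addr0 primS addrA.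
split => //=; first by rewrite !big_geq// addr0.
case=> x y /=; rewrite primS addr0.
(* [D z] is the error in the East increment at height [z]; closedness makes it constant in [z], and
   it vanishes on the axis. *)
pose D z := prim (fun y => b (x + 1, y)) z - prim (fun y => b (x, y)) z + a (x, 0) - a (x, z).
have DS z : D (z + 1) = D z.
  rewrite /D !primS; have := ab (x, z); rewrite addE addN /=; lra.
have D0 z : D z = 0.
  elim/int_rect: z => [|n IH|n IH].
  - by rewrite /D /= !big_geq// subrr add0r subrr.
  - by have := DS n; rewrite IH => <-; congr (D _); lia.
  - by have := DS (- n.+1%:Z); rewrite -IH => <-; congr (D _); lia.
have := D0 y; rewrite /D => D0y /=; lra.
Qed.

(** * Tilings as fields of directions *)

(* [dl p] points from the square [p] to the other square of its domino. *)
Definition domino_field (dl : pointZ -> direction) : Prop :=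
  forall p, dl (p + dvec (dl p)) = dopp (dl p).

Definition field_tiling (dl : pointZ -> direction) : set edge :=
  [set e | black e.1 /\ e.2 = e.1 + dvec (dl e.1)].

Lemma field_dvec dl p d : domino_field dl ->
  (dl (p + dvec d) == dopp d) = (dl p == d).
Proof.
move=> dlP; apply/eqP/eqP => [H|<-]; last exact: dlP.
by have := dlP (p + dvec d); rewrite H dvec_opp addrK doppK.
Qed.

Lemma field_tilingP dl : domino_field dl -> is_tiling (field_tiling dl).
Proof.
move=> dlP; split.
- case=> p q [/= pb ->]; rewrite /is_edge /= pb black_dvec pb /=.
  exact: share_side_dvec.
- have key (e : edge) s : field_tiling dl e -> in_domino s e ->
      e = if black s then (s, s + dvec (dl s)) else (s + dvec (dl s), s).
    case: e => p q [/= pb ->]; rewrite /in_domino /=.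
    case/orP => /eqP ->; first by rewrite pb.
    by rewrite black_dvec pb /= dlP dvec_opp addrK.
  by move=> e e' s /key te /key te' /te -> /te' ->.
- move=> s; case sb : (black s).
    by exists (s, s + dvec (dl s)); rewrite /in_domino ?eqxx//; split.
  exists (s + dvec (dl s), s); last by rewrite /in_domino eqxx orbT.
  by split; rewrite /= ?black_dvec ?sb// dlP dvec_opp addrK.
Qed.

(** Covering gives each square a partner; disjointness, applied at [p + dvec (dl p)], makes the
    choices of two partners agree. *)
Lemma tiling_field t : is_tiling t ->
  exists2 dl, domino_field dl & t = field_tiling dl.
Proof.
case=> tE tU tC.
have other s : exists d, t (if black s then (s, s + dvec d) else (s + dvec d, s)).
  have [[p q] te] := tC s; have /and3P[/= pb qw pq] := tE _ te.
  have [d qE] := share_sideP pq; rewrite /in_domino /= => /orP[]/eqP ->.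
    by exists d; rewrite pb -qE.
  by exists (dopp d); rewrite (negPf qw) qE dvec_opp addrK -qE.
have [dl dlt] := choice other; exists dl.
- move=> p; have := dlt p; have := dlt (p + dvec (dl p)).
  rewrite black_dvec; case: (black p) => /= t1 t2.
  + have := tU _ _ (p + dvec (dl p)) t1 t2.
    rewrite /in_domino /= !eqxx ?orbT => /(_ isT isT)/(congr1 fst)/=.
    rewrite -[in RHS](addr0 p) -addrA => /addrI/eqP.
    by rewrite addrC addr_eq0 -dvec_opp => /eqP/dvec_inj->; rewrite ?doppK.
  + have := tU _ _ (p + dvec (dl p)) t1 t2.
    rewrite /in_domino /= !eqxx ?orbT => /(_ isT isT)/(congr1 snd)/=.
    rewrite -[in RHS](addr0 p) -addrA => /addrI/eqP.
    by rewrite addrC addr_eq0 -dvec_opp => /eqP/dvec_inj->; rewrite ?doppK.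
- apply/seteqP; split => [[p q] te|[p q]].
    have /and3P[/= pb qw pq] := tE _ te.
    have := dlt p; rewrite pb => t'.
    have := tU _ _ p te t'; rewrite /in_domino /= eqxx /= => /(_ isT isT)[->].
    by split.
  by case=> /= pb ->; have := dlt p; rewrite pb.
Qed.

(** * Height functions *)

Definition chi (p : pointZ) : int := if black p then 1 else -1.

(** The unit edge from [u] to the east separates the square [u] from the one below it: no brick
    crosses it, and a domino does only when [dl u = South]. *)
Definition alpha (dl : pointZ -> direction) (u : pointZ) : int :=
  if dl u == South then - chi u else 0.

(** The unit edge from [u] to the north separates the square [u] from its west neighbour. A brick
    crosses it when [u] is white, a domino when [dl u = West]; a jump means that exactly one of the
    two happens. *)
Definition jump (dl : pointZ -> direction) (u : pointZ) : bool :=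
  black u == (dl u == West).

(* [F] is a quarter of the height function of the brick wall tiling minus the
   height function of the tiling given by [dl]. *)
Definition is_potential (dl : pointZ -> direction) (F : pointZ -> int) : Prop :=
  [/\ F 0 = 0, forall u, F (u + dvec East) = F u + alpha dl u &
      forall u, F (u + dvec North) = F u + (jump dl u)%:Z].

(** The increments sum to zero around the square [u] because exactly one of its sides is crossed in
    the tiling, and exactly one in the brick wall. *)
Lemma potential_field dl : domino_field dl -> exists F, is_potential dl F.
Proof.
move=> dlP; apply: potential_exists => u.
have := field_dvec u East dlP; have := field_dvec u North dlP.
rewrite /alpha /jump /chi !black_dvec /= => -> ->.
by case: (black u); case: (dl u).
Qed.

Lemma field_tilingE dl p d :
  field_tiling dl (p, p + dvec d) <-> black p && (dl p == d).
Proof.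
split=> [[/= -> /addrI/dvec_inj ->]|/andP[pb /eqP dE]]; first by rewrite eqxx.
by split=> //=; rewrite dE.
Qed.

Definition drot (d : direction) : direction :=
  match d with East => North | North => West | West => South | South => East end.

Lemma left_squareE (u : pointZ) d :
  left_square (u, d) = right_square (u, d) + dvec (drot d).
Proof. by case: u d => x y []; congr (_, _); rewrite /=; lia. Qed.

Lemma right_square_rev (u : pointZ) d :
  right_square (u + dvec d, dopp d) = left_square (u, d).
Proof. by case: u d => x y []; congr (_, _); rewrite /=; lia. Qed.

Lemma height_dominoE dl h :
  is_height (field_tiling dl) h <-> h 0 = 0 /\
  forall (u : pointZ) d, black (right_square (u, d)) ->
    h (u + dvec d) = h u + if dl (right_square (u, d)) == drot d then -3 else 1.
Proof.
split=> -[h0 hP]; split=> // u d ub.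
  have := hP u d ub; rewrite left_squareE => -[nt yt]; case: ifP => dE.
    by apply: yt; apply/field_tilingE; rewrite ub dE.
  by apply: nt => /field_tilingE; rewrite dE andbF.
rewrite /= left_squareE (hP u d ub); split=> [nt|/field_tilingE/andP[_ ->]//].
by case: ifP => // dE; case: nt; apply/field_tilingE; rewrite ub dE.
Qed.

(** Heights are prescribed along edges with a black square on the right. Reading all edges eastwards
    or northwards costs the sign [- chi u] or [chi u], as [u] is the left square of the first and
    the right square of the second. *)
Lemma height_steps dl h : domino_field dl ->
  is_height (field_tiling dl) h <->
  [/\ h 0 = 0,
    forall u, h (u + dvec East) = h u - chi u * (if dl u == South then -3 else 1) &
    forall u, h (u + dvec North) = h u + chi u * (if dl u == West then -3 else 1)].
Proof.
move=> dlP; rewrite height_dominoE.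
have rE (u : pointZ) : right_square (u, East) = u + dvec South.
  by case: u => x y; congr (_, _); rewrite /=; lia.
have rN (u : pointZ) : right_square (u, North) = u by [].
have rW (u : pointZ) : right_square (u + dvec East, West) = u.
  exact: right_square_rev u East.
have rS (u : pointZ) : right_square (u + dvec North, South) = u + dvec West.
  by rewrite (right_square_rev u North) left_squareE.
have KE (u : pointZ) : u + dvec East + dvec West = u.
  by rewrite -(addrA u) (dvec_opp East) subrr addr0.
have KN (u : pointZ) : u + dvec North + dvec South = u.
  by rewrite -(addrA u) (dvec_opp North) subrr addr0.
have dS u : (dl (u + dvec South) == North) = (dl u == South).
  exact: field_dvec u South dlP.
have dW u : (dl (u + dvec West) == East) = (dl u == West).
  exact: field_dvec u West dlP.
split=> [[h0 hP]|[h0 hE hN]]; split=> // u.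
- rewrite /chi; case ub: (black u).
    have := hP (u + dvec East) West; rewrite rW KE => /(_ ub) ->.
    by rewrite mul1r addrK.
  have := hP u East; rewrite rE black_dvec ub => /(_ isT) ->.
  by rewrite dS mulN1r opprK.
- rewrite /chi; case ub: (black u).
    by have := hP u North; rewrite rN => /(_ ub) ->; rewrite mul1r.
  have := hP (u + dvec North) South; rewrite rS KN black_dvec ub => /(_ isT) ->.
  by rewrite dW mulN1r addrK.
- case=> ub.
  + rewrite rE black_dvec in ub.
    by rewrite hE /chi (negPf ub) rE dS mulN1r opprK.
  + by rewrite rN in ub; rewrite hN /chi ub rN mul1r.
  + have uE : u = u + dvec West + dvec East by rewrite addrAC KE.
    move: ub; rewrite {}uE; move: (u + dvec West) => {}u.
    by rewrite rW KE => ub; rewrite hE /chi ub mul1r subrK.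
  + have uE : u = u + dvec South + dvec North by rewrite addrAC KN.
    move: ub; rewrite {}uE; move: (u + dvec South) => {}u.
    rewrite rS KN black_dvec => ub; rewrite hN /chi (negPf ub) dW.
    by rewrite mulN1r subrK.
Qed.

(** The part without [F] is the height function of the brick wall. *)
Lemma height_potential dl F h : domino_field dl -> is_potential dl F ->
  is_height (field_tiling dl) h <->
  forall u, h u = 2 * u.2 - (~~ black u)%:Z - 4 * F u.
Proof.
move=> dlP [F0 FE FN]; rewrite height_steps//.
have sE (u : pointZ) : (u + dvec East).2 = u.2 by rewrite /= addr0.
have sN (u : pointZ) : (u + dvec North).2 = u.2 + 1 by [].
split=> [[h0 hE hN] u|hF]; last first.
  split=> [|u|u]; first by rewrite hF F0.
    rewrite !hF FE black_dvec sE /alpha /chi.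
    by case: (black u); case: (dl u == South) => /=; lia.
  rewrite !hF FN black_dvec sN /jump /chi.
  by case: (black u); case: (dl u == West) => /=; lia.
pose k u := h u - (2 * u.2 - (~~ black u)%:Z - 4 * F u).
suff : k u = k 0 by rewrite /k h0 F0 /=; lia.
apply: const_of_steps => {}u; rewrite /k.
  rewrite hE FE black_dvec sE /alpha /chi.
  by case: (black u); case: (dl u == South) => /=; lia.
rewrite hN FN black_dvec sN /jump /chi.
by case: (black u); case: (dl u == West) => /=; lia.
Qed.

(** * Lattices *)

Definition subgroup (L : set pointZ) : Prop :=
  [/\ L 0, forall u v, L u -> L v -> L (u + v) & forall u, L u -> L (- u)].

Lemma subgroup_mulz L u (a : int) : subgroup L -> L u -> L (u *~ a).
Proof.
case=> L0 LD LN Lu; elim/int_rect: a => [|n IH|n IH]; first by rewrite mulr0z.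
  by rewrite intS mulrzDr mulr1z; apply: LD.
by rewrite intS opprD mulrzDr mulrNz mulr1z; apply: LD => //; apply: LN.
Qed.

Lemma mulz_pair (u : pointZ) (a : int) : u *~ a = (u.1 * a, u.2 * a).
Proof.
case: u => x y; elim/int_rect: a => [|n IH|n IH].
- by rewrite mulr0z !mulr0.
- by rewrite intS mulrzDr mulr1z IH; congr (_, _); rewrite /=; lia.
- rewrite intS opprD mulrzDr [_ *~ -1]mulrNz mulr1z IH.
  by congr (_, _); rewrite /=; lia.
Qed.

Lemma valid_subgroup L : valid_lattice L -> subgroup L.
Proof.
case=> v [w [_ _ _ ->]]; split.
- by exists 0, 0; rewrite !mulr0z addr0.
- move=> _ _ [a [b ->]] [c [d ->]]; exists (a + c), (b + d).
  by rewrite !mulrzDr addrACA.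
- by move=> _ [a [b ->]]; exists (- a), (- b); rewrite !mulrNz opprD.
Qed.

(** The vectors in question are those with even coordinate sum, a condition stable under integer
    combinations. *)
Lemma valid_even L v : valid_lattice L -> L v -> in_E v || in_O v.
Proof.
case=> u [w [uEO wEO _ ->]] [a [b ->]]; rewrite !mulz_pair.
move: u w uEO wEO => [x y] [x' y']; rewrite /in_O /in_E /= => H H'.
have : (exists k, x + y = 2 * k) /\ (exists k, x' + y' = 2 * k).
  by split; [exists ((x + y) %/ 2)%Z|exists ((x' + y') %/ 2)%Z]; lia.
case=> -[k xy] [k' xy'].
have : (x * a + x' * b) + (y * a + y' * b) = 2 * (k * a + k' * b).
  by transitivity ((x + y) * a + (x' + y') * b); [ring|rewrite xy xy'; ring].
by move: (x * a + x' * b) (y * a + y' * b) (k * a + k' * b) => A B C; lia.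
Qed.

Lemma black_lattice L p v : valid_lattice L -> L v -> black (p + v) = black p.
Proof.
move=> hL /(valid_even hL); case: p v => [x y] [x' y'].
by rewrite /in_O /in_E /black /=; lia.
Qed.

Section Basis.

Variables (L : set pointZ) (x0 x1 y1 : nat).
Hypotheses (hL : valid_lattice L) (hb : lattice_basis L x0 x1 y1).

(** Euclidean division by [y1] and then by [x0]: minimality of both kills the remainders. *)
Lemma lattice_gen v : L v ->
  exists a b : int, v = (x0%:Z, 0) *~ a + (x1%:Z, y1%:Z) *~ b.
Proof.
have [L0 LD LN] := valid_subgroup hL.
have LZ u a : L u -> L (u *~ a) by apply: subgroup_mulz; exact: valid_subgroup.
case: hb => -[x0p Lx0] x0min [y1p _] y1min [x1x0 Lx1] Lv.
pose b := (v.2 %/ y1%:Z)%Z.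
pose u := v + (x1%:Z, y1%:Z) *~ (- b).
have Lu : L u by apply: LD => //; apply: LZ.
have u2 : u.2 = (v.2 %% y1%:Z)%Z.
  by rewrite /u mulz_pair /= {1}(divz_eq v.2 y1%:Z) -/b; lia.
have u20 : u.2 = 0.
  have ge0 : 0 <= u.2 by rewrite u2 modz_ge0//; lia.
  have lt : u.2 < y1%:Z by rewrite u2 ltz_pmod//; lia.
  case E : (u.2) ge0 lt => [n|n]// _ lt.
  case: n E lt => // n E lt; suff : (y1 <= n.+1)%N by lia.
  by apply: y1min => //; exists u.1; rewrite -E -surjective_pairing.
pose a := (u.1 %/ x0%:Z)%Z.
pose w := u + (x0%:Z, 0) *~ (- a).
have Lw : L w by apply: LD => //; apply: LZ.
have w2 : w.2 = 0.
  have -> : w.2 = u.2 + 0 * (- a) by rewrite /w mulz_pair.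
  by rewrite u20 mul0r addr0.
have w1 : w.1 = (u.1 %% x0%:Z)%Z.
  have -> : w.1 = u.1 + x0%:Z * (- a) by rewrite /w mulz_pair.
  by have := divz_eq u.1 x0%:Z; rewrite -/a; lia.
have w10 : w.1 = 0.
  have ge0 : 0 <= w.1 by rewrite w1 modz_ge0//; lia.
  have lt : w.1 < x0%:Z by rewrite w1 ltz_pmod//; lia.
  case E : (w.1) ge0 lt => [n|n]// _ lt.
  case: n E lt => // n E lt; suff : (x0 <= n.+1)%N by lia.
  by apply: x0min => //; rewrite -E -w2 -surjective_pairing.
have w0 : w = 0 by rewrite (surjective_pairing w) w10 w2.
exists a, b; move: w0; rewrite /w /u !mulrNz => /eqP.
by rewrite subr_eq0 subr_eq => /eqP.
Qed.

Lemma domain_cover p : exists2 s, domain_squares x0 y1 s & L (p - s).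
Proof.
have [L0 LD LN] := valid_subgroup hL.
have LZ u a : L u -> L (u *~ a) by apply: subgroup_mulz; exact: valid_subgroup.
case: hb => -[x0p Lx0] x0min [y1p _] y1min [x1x0 Lx1].
pose b := (p.2 %/ y1%:Z)%Z; pose a := ((p.1 - x1%:Z * b) %/ x0%:Z)%Z.
exists (p - ((x0%:Z, 0) *~ a + (x1%:Z, y1%:Z) *~ b)); last first.
  by rewrite subKr; apply: LD; apply: LZ.
rewrite /domain_squares /= !mulz_pair /=.
have -> : p.1 - (x0%:Z * a + x1%:Z * b) = ((p.1 - x1%:Z * b) %% x0%:Z)%Z.
  by have := divz_eq (p.1 - x1%:Z * b) x0%:Z; rewrite -/a; lia.
have -> : p.2 - (0 * a + y1%:Z * b) = (p.2 %% y1%:Z)%Z.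
  by have := divz_eq p.2 y1%:Z; rewrite -/b; lia.
by rewrite !modz_ge0 ?ltz_pmod; lia.
Qed.

Lemma small_lattice v : L v -> `|v.2| < y1%:Z -> `|v.1| < x0%:Z -> v = 0.
Proof.
move=> /lattice_gen[a [b ->]]; rewrite !mulz_pair /=.
have [[x0p _] _ [y1p _] _ _] := hb.
have nz (c : int) (n : nat) : (0 < n)%N -> `|n%:Z * c| < n%:Z -> c = 0.
  by move=> n0; rewrite normrM ger0_norm// gtr_pMr; lia.
rewrite mul0r add0r => /(nz _ _ y1p) ->; rewrite mulr0 addr0.
by move=> /(nz _ _ x0p) ->; rewrite !mulr0.
Qed.

Lemma domain_inj s s' : domain_squares x0 y1 s -> domain_squares x0 y1 s' ->
  L (s - s') -> s = s'.
Proof.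
rewrite /domain_squares /= => /andP[s1 s2] /andP[s1' s2'] /small_lattice H.
apply/eqP; rewrite -subr_eq0; apply/eqP/H => /=; lia.
Qed.

End Basis.

(** * Flux *)

Definition periodic (L : set pointZ) (dl : pointZ -> direction) : Prop :=
  forall v, L v -> forall p, dl (p + v) = dl p.

Lemma field_torus L dl : valid_lattice L -> domino_field dl -> periodic L dl ->
  torus_tiling L (field_tiling dl).
Proof.
move=> hL dlP per; split; first exact: field_tilingP.
move=> v Lv [p q] [/= pb ->]; split => /=; first by rewrite (black_lattice _ hL).
by rewrite (per v Lv) addrAC.
Qed.

Lemma torus_field L t : torus_tiling L t ->
  exists dl, [/\ domino_field dl, periodic L dl & t = field_tiling dl].
Proof.
case=> /tiling_field[dl dlP ->] per; exists dl; split=> // v Lv.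
have perb p : black p -> dl (p + v) = dl p.
  move=> pb; have [] : field_tiling dl (translate (p, p + dvec (dl p)) v).
    by apply: per.
  by rewrite /= addrAC => _ /addrI/dvec_inj.
(* A white square inherits periodicity from its black partner [q]. *)
move=> p; case pb : (black p); first exact: perb.
pose q := p + dvec (dl p).
have qb : black q by rewrite black_dvec pb.
have := dlP (q + v); rewrite (perb q qb) dlP dvec_opp.
by rewrite addrAC addrK doppK.
Qed.

(** The increments of [F] depend only on colours and [dl], both [L]-periodic, so [F (u + v) - F u]
    does not depend on [u]. *)
Lemma potential_add L dl F u v : valid_lattice L -> periodic L dl ->
  is_potential dl F -> L v -> F (u + v) = F u + F v.
Proof.
move=> hL per [F0 FE FN] Lv.
suff : F (u + v) - F u = F (0 + v) - F 0.
  by rewrite F0 subr0 add0r => <-; rewrite addrCA subrr addr0.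
pose k u := F (u + v) - F u; apply: (@const_of_steps _ k) => {}u; rewrite /k.
  by rewrite addrAC !FE /alpha /chi (black_lattice _ hL)// per//; ring.
by rewrite addrAC !FN /jump (black_lattice _ hL)// per//; ring.
Qed.

Lemma innerD (R : realType) (phi : R * R) u v :
  inner phi (u + v) = inner phi u + inner phi v.
Proof. by rewrite /inner /= !rmorphD /=; ring. Qed.

Lemma innerZ (R : realType) (phi : R * R) u (a : int) :
  inner phi (u *~ a) = inner phi u * a%:~R.
Proof. by rewrite /inner mulz_pair /= !rmorphM /=; ring. Qed.

Section Flux.

Variables (R : realType) (L : set pointZ) (x0 x1 y1 : nat).
Hypotheses (hL : valid_lattice L) (hb : lattice_basis L x0 x1 y1).
Variables (dl : pointZ -> direction) (F : pointZ -> int).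
Hypotheses (dlP : domino_field dl) (per : periodic L dl) (FP : is_potential dl F).

Lemma flux_potential (phi : R * R) : is_flux L (field_tiling dl) phi <->
  forall v, L v -> inner phi v = v.2%:~R / 2 - (F v)%:~R.
Proof.
have hD h v u : is_height (field_tiling dl) h -> L v ->
    h (u + v) - h u = 2 * v.2 - 4 * F v.
  move=> /(height_potential _ dlP FP) hF Lv.
  rewrite !hF (black_lattice _ hL)// (potential_add _ hL per FP Lv) /=; lia.
split=> [[h hP hphi] v Lv|H].
  have := hphi v Lv 0; rewrite (hD _ _ _ hP Lv) rmorphB /= !rmorphM /=; lra.
exists (fun u => 2 * u.2 - (~~ black u)%:Z - 4 * F u).
  by apply/(height_potential _ dlP FP).
move=> v Lv u.
rewrite (black_lattice _ hL)// (potential_add _ hL per FP Lv) /= H//.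
rewrite !(rmorphB, rmorphD, rmorphM) /=; lra.
Qed.

Lemma flux_basis (phi : R * R) : is_flux L (field_tiling dl) phi <->
  inner phi (x0%:Z, 0) = - (F (x0%:Z, 0))%:~R /\
  inner phi (x1%:Z, y1%:Z) = y1%:R / 2 - (F (x1%:Z, y1%:Z))%:~R.
Proof.
have [L0 LD LN] := valid_subgroup hL.
have [[x0p Lx0] _ _ _ [_ Lx1]] := hb.
rewrite flux_potential; split=> [H|[H0 H1] v /(lattice_gen hL hb)[a [b ->]]].
  by rewrite !H//=; split=> //; rewrite mul0r sub0r.
have FZ w c : L w -> F (w *~ c) = F w * c.
  move=> Lw; have LZ e : L (w *~ e) by apply: subgroup_mulz.
  have [F0 _ _] := FP; elim/int_rect: c => [|n IH|n IH].
  - by rewrite mulr0z mulr0.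
  - by rewrite intS addrC mulrzDr mulr1z (potential_add _ hL per FP Lw) IH; ring.
  - have := potential_add (w *~ - n.+1%:Z) hL per FP Lw.
    rewrite -{2}[w]mulr1z -mulrzDr.
    by rewrite (_ : - n.+1%:Z + 1 = - n%:Z) ?IH; [rewrite intS; lra|lia].
rewrite innerD !innerZ H0 H1 (potential_add _ hL per FP); last exact: subgroup_mulz.
rewrite !FZ// !mulz_pair /= !(rmorphD, rmorphM) /= mul0r add0r; ring.
Qed.

(** [v_1] lies in the odd class exactly when [y1] is odd, so the half-integer shift replaces y1/2 by
    the integer [y1./2]. *)
Lemma flux_corresponds (phi : R * R) (i j : int) : corresponds x0 x1 y1 phi i j ->
  is_flux L (field_tiling dl) phi <->
  (i = - F (x0%:Z, 0) /\ j = y1./2%:Z - F (x1%:Z, y1%:Z)).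
Proof.
have [_ _ _ _ [_ Lx1]] := hb.
case=> hi hE hO; rewrite flux_basis -hi.
rewrite -[- _%:~R]rmorphN /=.
have inj (a c : int) : (a%:~R = c%:~R :> R) <-> a = c.
  by split=> [/eqP|->//]; rewrite eqr_int => /eqP.
rewrite inj.
have y1E : y1%:R / 2 = (y1./2%:Z)%:~R + (odd y1)%:R / 2 :> R.
  rewrite -[(y1./2%:Z)%:~R]/(y1./2%:R : R).
  by rewrite -[in LHS](odd_double_half y1) natrD -muln2 natrM; field.
suff -> : inner phi (x1%:Z, y1%:Z) = j%:~R + (odd y1)%:R / 2.
  rewrite y1E -(inj j) rmorphB /=.
  by split=> -[-> H]; split=> //; move: H; lra.
have := valid_even hL Lx1; case/orP => H.
  rewrite hE//; suff -> : odd y1 = false by rewrite mul0r addr0.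
  by move: H; rewrite /in_E /=; lia.
rewrite hO//; suff -> : odd y1 by rewrite /= mul1r subrK.
by move: H; rewrite /in_O /in_E /=; lia.
Qed.

(** Contribution of the step [s] to the exponent of the monomial of the tiling; [drot s.2] points
    from the right square to the left one. *)
Definition cross (s : pointZ * direction) : int :=
  (black (left_square s) && (dl (left_square s) == dopp (drot s.2)))%:Z -
  (black (right_square s) && (dl (right_square s) == drot s.2))%:Z.

Lemma crossE u : cross (u, East) = - alpha dl u.
Proof.
have rE : right_square (u, East) = u + dvec South.
  by case: u => x y; congr (_, _); rewrite /=; lia.
rewrite /cross rE black_dvec (field_dvec u South dlP).
rewrite /alpha /chi -[left_square _]/u /=.
by case: (black u); case: (dl u == South).
Qed.

Lemma crossN u : cross (u, North) = (~~ black u)%:Z - (jump dl u)%:Z.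
Proof.
rewrite /cross left_squareE -[right_square _]/u -[(_, _).2]/North -[drot North]/West black_dvec.
rewrite (field_dvec u West dlP) /jump.
by case: (black u); case: (dl u == West).
Qed.

Lemma sum_alpha (y : int) n :
  \sum_(i <- iota 0 n) alpha dl (i%:Z, y) = F (n%:Z, y) - F (0, y).
Proof.
have [_ FE _] := FP.
elim: n => [|n IH]; first by rewrite big_nil subrr.
have -> : (n.+1%:Z, y) = (n%:Z, y) + dvec East by rewrite addE intS addrC.
by rewrite -addn1 iotaD big_cat IH /= big_seq1 FE add0n addrAC.
Qed.

Lemma sum_jump (x : int) n :
  \sum_(j <- iota 0 n) (jump dl (x, j%:Z))%:Z = F (x, n%:Z) - F (x, 0).
Proof.
have [_ _ FN] := FP.
elim: n => [|n IH]; first by rewrite big_nil subrr.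
have -> : (x, n.+1%:Z) = (x, n%:Z) + dvec North by rewrite addN intS addrC.
by rewrite -addn1 iotaD big_cat IH /= big_seq1 FN add0n addrAC.
Qed.

Lemma cross_path0 : \sum_(s <- path0 x0) cross s = - F (x0%:Z, 0).
Proof.
have [F0 _ _] := FP.
rewrite big_map (eq_bigr _ (fun k _ => crossE _)) sumrN sum_alpha.
by rewrite F0 subr0.
Qed.

(** Counts the bricks crossing the vertical part of [path1]; this is the source of [y1./2] in
    [flux_corresponds]. *)
Lemma sum_white n : \sum_(j <- iota 0 n) (~~ black (0, j%:Z))%:Z = n./2%:Z.
Proof.
elim: n => [|n IH]; first by rewrite big_nil.
rewrite -addn1 iotaD big_cat IH /= big_seq1 add0n addn1 /black /=; lia.
Qed.

Lemma cross_path1 :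
  \sum_(s <- path1 x1 y1) cross s = y1./2%:Z - F (x1%:Z, y1%:Z).
Proof.
have [F0 _ _] := FP.
rewrite big_cat !big_map (eq_bigr _ (fun k _ => crossN _)).
rewrite (eq_bigr _ (fun k _ => crossE _)) sumrN sum_alpha.
rewrite sumrB sum_white sum_jump F0 /=; ring.
Qed.

End Flux.

(** * Level lines and signs *)

Definition next (dl : pointZ -> direction) (p : pointZ) : pointZ :=
  p + dvec (dl p) - dvec East.

Section Labels.

Variables (dl : pointZ -> direction) (F : pointZ -> int).
Hypotheses (dlP : domino_field dl) (FP : is_potential dl F).

Lemma potential_le x y (n : nat) : F (x, y) <= F (x, y + n%:Z).
Proof.
have [_ _ FN] := FP; elim: n => [|n IH]; first by rewrite addr0.
apply: le_trans IH _.
have -> : (x, y + n.+1%:Z) = (x, y + n%:Z) + dvec North.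
  by rewrite addN intS; congr (_, _); lia.
by rewrite FN lerDl.
Qed.

(** [F] is nondecreasing along a column and grows at a jump, so each level is left at most once. *)
Lemma jump_uniq u u' : jump dl u -> jump dl u' -> u.1 = u'.1 -> F u = F u' -> u = u'.
Proof.
have [_ _ FN] := FP.
have aux x (y y' : int) : y < y' -> jump dl (x, y) -> F (x, y) < F (x, y').
  move=> lt ju; have := potential_le x (y + 1) (absz (y' - (y + 1))%R).
  rewrite (_ : y + 1 + _ = y'); last lia.
  by rewrite -addN FN ju; apply: lt_le_trans; rewrite ltrDl.
case: u u' => [x y] [x' y'] /= ju ju' xE; rewrite -{}xE in ju' * => FE.
by case: (ltrgtP y y') => [/aux/(_ ju)|/aux/(_ ju')|->//]; rewrite FE ltxx.
Qed.

(** The square east of [p] completes its brick, so a jump there marks [p] as moving. *)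
Lemma jump_east p : black p -> jump dl (p + dvec East) = (dl p != East).
Proof. by move=> pb; rewrite /jump black_dvec pb (field_dvec p East dlP); case: (dl p == East). Qed.

Lemma potential_west p : black p -> dl p = West -> F (p + dvec East) = F p.
Proof.
have [_ FE _] := FP.
by move=> pb dp; rewrite FE /alpha dp addr0.
Qed.

Lemma nextE p : next dl p + dvec East = p + dvec (dl p).
Proof. by rewrite /next subrK. Qed.

(** For [North] and [West] all increments between the two points vanish; for [South] the East
    increment of -1 at [p] cancels the jump below [p]. *)
Lemma label_next p : black p -> dl p != East ->
  dl (next dl p) != East /\ F (next dl p + dvec East) = F (p + dvec East).
Proof.
have [_ FE FN] := FP.
move=> pb dp; have nb : black (next dl p) by rewrite /next blackB black_dvec pb.
have jn : jump dl (p + dvec (dl p)).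
  rewrite /jump black_dvec pb dlP; by case: (dl p) dp.
split; first by rewrite -jump_east// nextE.
rewrite nextE; case dE : (dl p) (jn) dp => // _ _.
- by rewrite FN FE /alpha /jump pb dE.
- rewrite potential_west//.
  have := FE (p + dvec West); rewrite -[dvec West]/(dvec (dopp East)) dvec_opp subrK => ->.
  rewrite /alpha; case: eqP => [dS|]; last by rewrite addr0.
  by have := dlP p; rewrite dE -[dvec West]/(dvec (dopp East)) dvec_opp dS.
- rewrite FE /alpha dE eqxx /chi pb.
  have := FN (p + dvec South).
  rewrite -[dvec South]/(dvec (dopp North)) dvec_opp subrK => ->.
  by rewrite -dvec_opp -[dopp North]/South -dE jn addrK.
Qed.

Lemma column_hits x (Y : nat) (S : int) c : 0 < S ->
  (forall y, F (x, y + Y%:Z) = F (x, y) + S) -> exists2 y, jump dl (x, y) & F (x, y) = c.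
Proof.
have [_ _ FN] := FP.
move=> S0 FY.
have FYn y (n : nat) : F (x, y + (n * Y)%:Z) = F (x, y) + S * n%:Z.
  elim: n => [|n IH]; first by rewrite mul0n mulr0 !addr0.
  by rewrite mulSn addnC PoszD addrA FY IH intS; ring.
have abs_le (d : int) : `|d| <= S * (absz d)%:Z by rewrite -abszE ler_peMl; lia.
(* Each period changes [F] by at least 1, so as many periods as the distance to the target suffice,
   downwards here and upwards next. *)
have [y0 Fy0] : exists y0, F (x, y0) <= c.
  pose N := absz (F (x, 0) - c)%R; exists (- (N * Y)%N%:Z).
  have := FYn (- (N * Y)%N%:Z) N; rewrite addNr => E.
  have := abs_le (F (x, 0) - c); rewrite -/N E.
  by have := ler_norm (F (x, 0) - c); rewrite E; lra.
have [n Fn] : exists n : nat, c < F (x, y0 + n%:Z).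
  pose N := absz (c + 1 - F (x, y0))%R; exists (N * Y)%N; rewrite FYn.
  have := abs_le (c + 1 - F (x, y0)); rewrite -/N.
  by have := ler_norm (c + 1 - F (x, y0)); lra.
(* Discrete intermediate values: as increments are 0 or 1, the last point with [F <= c] has [F = c]
   and is a jump. *)
elim: n Fn => [|n IH] Fn; first by move: Fn; rewrite addr0 ltNge Fy0.
case: (ltP c (F (x, y0 + n%:Z))) => [/IH//|le].
have E : (x, y0 + n.+1%:Z) = (x, y0 + n%:Z) + dvec North.
  by rewrite addN intS; congr (_, _); lia.
move: Fn; rewrite E FN; case: (boolP (jump _ _)) => [ju|_] /= lt.
  by exists (y0 + n%:Z) => //; apply/eqP; rewrite eq_le le -ltzD1 lt.
by move: lt; rewrite addr0 ltNge le.
Qed.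

(** A jump at a white square marks the black square to its west; at a black square it forces [West],
    and the level one step east is the same. *)
Lemma label_hits x (Y : nat) (S : int) c : 0 < S ->
  (forall y, F (x, y + Y%:Z) = F (x, y) + S) ->
  exists q, [/\ black q, dl q != East & F (q + dvec East) = c].
Proof.
move=> S0 FY; have [y ju Fc] := column_hits c S0 FY.
case ub : (black (x, y)).
  have dW : dl (x, y) = West by move: ju; rewrite /jump ub => /eqP/esym/eqP.
  by exists (x, y); rewrite ub dW potential_west.
exists ((x, y) - dvec East); rewrite blackB ub subrK; split=> //.
by rewrite -jump_east ?blackB ?ub// subrK.
Qed.

End Labels.

(** * Cycles of moving squares on the torus *)

Lemma leq_card_imset_factor (T U U' : finType) (u0 : U) (A : {set T})
    (f : T -> U) (f' : T -> U') :
  {in A &, forall i j, f' i = f' j -> f i = f j} -> (#|f @: A| <= #|f' @: A|)%N.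
Proof.
move=> ff'.
(* On [A], [f] factors through [f']; [g] is the factor, with [u0] as its value off the image. *)
pose g u' := if [pick i in A | f' i == u'] is Some i then f i else u0.
have -> : f @: A = g @: (f' @: A).
  rewrite -imset_comp; apply: eq_in_imset => i iA; rewrite /g /=.
  case: pickP => [j /andP[jA /eqP]|/(_ i)]; last by rewrite iA eqxx.
  by move/esym; exact: ff'.
exact: leq_imset_card.
Qed.

Lemma next_add L dl p v : periodic L dl -> L v -> next dl (p + v) = next dl p + v.
Proof. by move=> per Lv; rewrite /next per// (addrAC p v) (addrAC _ v). Qed.

Section Orbits.

Variables (L : set pointZ) (m : nat) (b : 'I_m -> pointZ).
Hypotheses (hL : valid_lattice L) (b_black : forall i, black (b i)).
Hypothesis b_inj : forall i j, L (b i - b j) -> i = j.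
Hypothesis b_cover : forall p, black p -> exists i, L (p - b i).

Definition follows (dl : pointZ -> direction) (pi : {perm 'I_m}) : Prop :=
  forall i, L (next dl (b i) - b (pi i)).

Definition moving (dl : pointZ -> direction) : {set 'I_m} :=
  [set i | dl (b i) != East].

Section OneField.

Variables (dl : pointZ -> direction) (F : pointZ -> int) (pi : {perm 'I_m}).
Hypotheses (dlP : domino_field dl) (per : periodic L dl) (FP : is_potential dl F).
Hypothesis dl_pi : follows dl pi.

(* The orbit of [p] moves left by one or two columns at each step.  It cannot
   jump over [q]: at a step of two, the level line passes through the column
   of [q] at a black square, whereas [q] is marked by a white one. *)
Lemma label_connected (n : nat) i j p q : L (p - b i) -> L (q - b j) ->
  dl p != East -> dl q != East -> F (p + dvec East) = F (q + dvec East) ->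
  p.1 - q.1 = n%:Z -> porbit pi i = porbit pi j.
Proof.
have [L0 LD LN] := valid_subgroup hL.
elim/ltn_ind: n i p => n IH i p Lp Lq dp dq Fpq pq.
have pb : black p by rewrite -(subrK (b i) p) addrC (black_lattice _ hL).
have qb : black q by rewrite -(subrK (b j) q) addrC (black_lattice _ hL).
have jq : jump dl (q + dvec East) by rewrite jump_east.
case: n IH pq => [|n] IH pq.
  have pqE : p = q.
    apply: (addIr (dvec East)); apply: (jump_uniq FP) => //; first by rewrite jump_east.
    by congr (_ + _); apply/eqP; rewrite -subr_eq0 pq.
  suff -> : i = j by [].
  apply: b_inj; rewrite (_ : b i - b j = (q - b j) - (p - b i)).
    by apply: LD => //; apply: LN.
  by rewrite pqE opprB [RHS]addrC addrA subrK.
have [dn Fn] := label_next dlP FP pb dp.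
have Ln : L (next dl p - b (pi i)).
  have pE : p = b i + (p - b i) by rewrite addrC subrK.
  rewrite {1}pE (next_add _ per Lp) addrAC.
  by apply: LD.
have nx : (next dl p).1 = p.1 + (dvec (dl p)).1 - 1 by [].
have orb : porbit pi (pi i) = porbit pi i.
  by have := porbit_perm pi 1 i; rewrite expg1.
rewrite -orb.
have [dW|dW] := eqVneq (dl p) West; last first.
  apply: (IH n) Ln Lq dn dq _ _ => //; first by rewrite Fn.
  by rewrite nx; move: pq; rewrite intS; case: (dl p) dp dW => //= _ _; lra.
case: n IH pq => [|n] IH pq; last first.
  apply: (IH n) Ln Lq dn dq _ _ => //; first by rewrite Fn.
  by rewrite nx dW /=; move: pq; rewrite !intS; lra.
(* The jumps at [p] and [q + dvec East] share column and level, hence coincide, against their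
   colours. *)
have jp : jump dl p by rewrite /jump pb dW.
suff pE : p = q + dvec East by move: pb; rewrite pE black_dvec qb.
apply: (jump_uniq FP) => //; first by move: pq; rewrite /=; lra.
by rewrite -Fpq (potential_west FP).
Qed.

(** [next] preserves labels, and returning to the representative [b (pi k)] shifts them by a
    period. *)
Lemma label_porbit i j : i \in moving dl -> j \in porbit pi i ->
  j \in moving dl /\ exists2 v, L v & F (b j + dvec East) = F (b i + dvec East) + F v.
Proof.
have [L0 LD LN] := valid_subgroup hL; have [F0 _ _] := FP.
move=> iA /porbitP[n ->]; elim: n => [|n [kA [v Lv Fv]]].
  by rewrite expg0 perm1; split=> //; exists 0 => //; rewrite F0 addr0.
rewrite expgSr permM; move: ((pi ^+ n)%g i) kA Fv => k; rewrite !inE => kA Fv.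
have [dn Fn] := label_next dlP FP (b_black k) kA.
have Lk := dl_pi k; pose u := next dl (b k) - b (pi k).
have bE : b (pi k) = next dl (b k) - u by rewrite /u opprB addrC subrK.
have Lu : L (- u) by apply: LN.
split; first by rewrite bE per.
exists (v - u); first exact: LD.
rewrite bE addrAC !(potential_add _ hL per FP Lu) Fn Fv addrA.
by [].
Qed.

(** A square starting a brick of the tiling is fixed by [pi], so its orbit is a singleton and
    contains no moving square. *)
Lemma card_porbits_fixed :
  #|porbits pi| = (#|~: moving dl| + #|porbit pi @: moving dl|)%N.
Proof.
have fixpi i : i \notin moving dl -> pi i = i.
  rewrite inE negbK => /eqP dE; apply/esym/b_inj.
  by have := dl_pi i; rewrite /next dE addrK.
have orb1 i : i \notin moving dl -> porbit pi i = [set i]%SET.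
  move=> /fixpi fi; apply/setP => j; rewrite inE; apply/porbitP/eqP => [[n ->]|->].
    by elim: n => [|n IH]; rewrite ?expg0 ?perm1// expgSr permM IH.
  by exists 0%N; rewrite expg0 perm1.
have -> : porbits pi = porbit pi @: (~: moving dl :|: moving dl)%SET.
  apply/setP => X; apply/imsetP/imsetP => -[i _ ->]; exists i => //.
  by rewrite !inE orNb.
rewrite imsetU cardsU disjoint_setI0 ?cards0 ?subn0.
  congr (_ + _)%N; apply: card_in_imset => i j; rewrite !inE !negbK => /eqP di /eqP dj.
  by rewrite !orb1 ?inE ?negbK ?di ?dj//; exact: set1_inj.
rewrite disjoint_sym; apply/pred0P => X /=; apply/negP => /andP[].
move=> /imsetP[i iA ->] /imsetP[j]; rewrite inE => jA.
rewrite (orb1 j jA) => /setP/(_ i); rewrite porbit_id inE => /esym/eqP ij.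
by rewrite -ij iA in jA.
Qed.

End OneField.

(* The label of a moving black square [p] is [F (p + dvec East)].  Every label is
   met by [dl'] as soon as [dl] moves some square, and two moving squares are in
   the same orbit exactly when their labels agree modulo the periods [F(L)]. *)
Lemma leq_moving_orbits dl F pi dl' F' pi' :
  domino_field dl -> periodic L dl -> is_potential dl F -> follows dl pi ->
  domino_field dl' -> periodic L dl' -> is_potential dl' F' -> follows dl' pi' ->
  (forall v, L v -> F v = F' v) -> (exists Y : nat, (0 < Y)%N /\ L (0, Y%:Z)) ->
  (#|porbit pi @: moving dl| <= #|porbit pi' @: moving dl'|)%N.
Proof.
have [L0 LD LN] := valid_subgroup hL.
move=> dlP per FP dl_pi dlP' per' FP' dl_pi' FLE [Y [Y0 LY]].
have mate i : exists i', i \in moving dl -> i' \in moving dl' /\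
    exists2 v, L v & F (b i + dvec East) = F' (b i' + dvec East) + F' v.
  case: (boolP (i \in moving dl)) => [iA|]; last by exists i.
  (* The jump next to [b i] makes [F] grow strictly in its column, and monotonicity keeps this gain
     over the remaining [Y.-1] steps. *)
  have S0 : 0 < F (0, Y%:Z).
    have ji : jump dl (b i + dvec East) by rewrite jump_east//; move: iA; rewrite inE.
    have [_ _ FN] := FP; move: ji; case E : (b i + dvec East) => [x y] ji.
    have := potential_add (x, y) hL per FP LY.
    rewrite (_ : (x, y) + _ = (x, y + 1 + Y.-1%:Z)); last first.
      by congr (_, _); rewrite /= ?addr0//; lia.
    have := potential_le FP x (y + 1) Y.-1.
    have := FN (x, y); rewrite addN ji => -> le E'.
    by rewrite E' in le; move: le; rewrite lerD2l; apply: lt_le_trans.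
  have FY' y : F' ((b i).1 + 1, y + Y%:Z) = F' ((b i).1 + 1, y) + F (0, Y%:Z).
    rewrite FLE// -(potential_add _ hL per' FP' LY); congr (F' (_, _)).
    by rewrite /= addr0.
  have [q [qb dq Fq]] := label_hits dlP' FP' (F (b i + dvec East)) S0 FY'.
  have [i' Li'] := b_cover qb; exists i' => _; split.
    rewrite inE (_ : b i' = q - (q - b i')); last by rewrite subKr.
    by rewrite per'//; apply: LN.
  exists (q - b i') => //; rewrite -Fq -(potential_add _ hL per' FP' Li').
  by rewrite addrAC (addrC (b i')) subrK.
have [f fP] := choice mate.
apply: (@leq_trans #|(fun i => porbit pi' (f i)) @: moving dl|); last first.
  apply: subset_leq_card; apply/fintype.subsetP => _ /imsetP[i iA ->].
  by apply: imset_f; have [] := fP i iA.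
(* It remains to see that the orbit of [f i] determines that of [i]. *)
apply: leq_card_imset_factor; first exact: finset.set0.
move=> i j iA jA /eqP; rewrite eq_porbit_mem => orb.
have [fjA [vj Lvj Fj]] := fP j jA; have [_ [vi Lvi Fi]] := fP i iA.
have [_ [v Lv Fv]] := label_porbit dlP' per' FP' dl_pi' fjA orb.
(* The lift [b j + w] gets exactly the label of [b i], so connectedness in the plane applies. *)
have [w Lw Fw] : exists2 w, L w & F (b i + dvec East) = F (b j + w + dvec East).
  have LNj : L (- vj) by apply: LN.
  have Lvv : L (v + vi) by apply: (LD).
  have Lw : L (v + vi - vj) by apply: (LD).
  exists (v + vi - vj) => //.
  rewrite addrAC (potential_add _ hL per FP Lw) Fi Fj Fv FLE//.
  rewrite (potential_add _ hL per' FP' LNj) (potential_add _ hL per' FP' Lvi).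
  have [F0 _ _] := FP'; have := potential_add vj hL per' FP' LNj.
  by rewrite subrr F0; lra.
move: iA jA; rewrite !inE => iA jA.
have jA' : dl (b j + w) != East by rewrite per.
have Lj : L (b j + w - b j) by rewrite addrAC subrr add0r.
have Li : L (b i - b i) by rewrite subrr.
(* Level lines run leftwards, so the start is the lift further to the right. *)
have [ge|lt] := lerP (b j + w).1 (b i).1.
  apply: (label_connected dlP per FP dl_pi Li Lj iA jA' Fw (n := absz ((b i).1 - (b j + w).1)%R)).
  by rewrite gez0_abs// subr_ge0.
apply/esym.
apply: (label_connected dlP per FP dl_pi Lj Li jA' iA (esym Fw) (n := absz ((b j + w).1 - (b i).1)%R)).
by rewrite gez0_abs// subr_ge0 ltW.
Qed.

End Orbits.

(** * Weights of orbits *)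

Lemma count_le1 (T : eqType) (P : pred T) (r : seq T) : uniq r ->
  {in r &, forall x y, P x -> P y -> x = y} -> count P r = has P r.
Proof.
elim: r => //= x r IH /andP[xr ur] inj.
rewrite IH// => [|y z yr zr]; last by apply: inj; rewrite inE ?yr ?zr orbT.
case Px : (P x) => //=; case: hasP => // -[y yr Py].
have xy : x = y by apply: inj => //; rewrite inE ?eqxx ?yr ?orbT.
by rewrite xy yr in xr.
Qed.

Lemma sum_int_has (T : eqType) (P : pred T) (r : seq T) : uniq r ->
  {in r &, forall x y, P x -> P y -> x = y} ->
  \sum_(x <- r) (P x : nat)%:Z = (has P r)%:Z.
Proof.
move=> ur inj; rewrite -count_le1//; elim: r {ur inj} => [|x r IH].
  by rewrite big_nil.
by rewrite big_cons IH /= PoszD.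
Qed.

Section Crossings.

Variable L : set pointZ.
Hypothesis hL : valid_lattice L.

(** Under these conditions an orbit of edges crosses the path at most once. *)
Definition simple_path (p : seq (pointZ * direction)) : Prop :=
  [/\ uniq p, all [pred s | (s.2 == East) || (s.2 == North)] p &
      {in p &, forall s s', s.2 = s'.2 -> L (s.1 - s'.1) -> s = s'}].

Lemma orbit_trans e e1 e2 : Defs.orbit L e e1 -> Defs.orbit L e e2 ->
  exists2 v, L v & e1 = (e2.1 + v, e2.2 + v).
Proof.
have [L0 LD LN] := valid_subgroup hL.
move=> [v2 L2 ->] [v1 L1 ->]; exists (v2 - v1); first by apply: LD => //; apply: LN.
by congr (_, _); rewrite /= -addrA; congr (_ + _); rewrite addrC subrK.
Qed.

Lemma drot_inj : injective drot. Proof. by case; case. Qed.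

Lemma left_diff (s : pointZ * direction) :
  left_square s - right_square s = dvec (drot s.2).
Proof. by case: s => u d; rewrite left_squareE addrAC subrr add0r. Qed.

(** Two crossings with black on the same side come from equivalent steps, hence from one step;
    crossings with black on opposite sides would need opposite directions, but only [East] and
    [North] occur. *)
Lemma q_exponentE p e : simple_path p ->
  q_exponent p (Defs.orbit L e) = \sum_(s <- p)
    ((`[< Defs.orbit L e (left_square s, right_square s) >] : nat)%:Z -
     (`[< Defs.orbit L e (right_square s, left_square s) >] : nat)%:Z).
Proof.
case=> up dirp simp.
have diffE (x y v : pointZ) : (x + v) - (y + v) = x - y.
  by rewrite opprD addrACA subrr addr0.
have rightE (s s' : pointZ * direction) v : s.2 = s'.2 ->
    right_square s = right_square s' + v -> s.1 - s'.1 = v.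
  case: s s' => [[x y] d] [[x' y'] _] /= <-.
  by case: d => -[]; rewrite /= => h1 h2; rewrite (surjective_pairing v);
     congr (_, _); rewrite /=; lia.
have injl : {in p &, forall s s',
    `[< Defs.orbit L e (left_square s, right_square s) >] ->
    `[< Defs.orbit L e (left_square s', right_square s') >] -> s = s'}.
  move=> s s' ps ps' /asboolP o /asboolP o'.
  have [v Lv [El Er]] := orbit_trans o o'.
  have d : s.2 = s'.2.
    by apply/drot_inj/dvec_inj; rewrite -!left_diff El Er /= diffE.
  by apply: simp => //; rewrite (rightE _ _ v d Er).
have injr : {in p &, forall s s',
    `[< Defs.orbit L e (right_square s, left_square s) >] ->
    `[< Defs.orbit L e (right_square s', left_square s') >] -> s = s'}.
  move=> s s' ps ps' /asboolP o /asboolP o'.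
  have [v Lv [Er El]] := orbit_trans o o'.
  have d : s.2 = s'.2.
    by apply/drot_inj/dvec_inj; rewrite -!left_diff El Er /= diffE.
  by apply: simp => //; rewrite (rightE _ _ v d Er).
rewrite sumrB.
rewrite (@sum_int_has _ (fun s => `[< Defs.orbit L e (left_square s, right_square s) >]))//.
rewrite (@sum_int_has _ (fun s => `[< Defs.orbit L e (right_square s, left_square s) >]))//.
have meetsE (f : pointZ * direction -> pointZ * pointZ) :
    Defs.meets (Defs.orbit L e) (fun e => e \in [seq f s | s <- p]) =
    has (fun s => `[< Defs.orbit L e (f s) >]) p.
  apply/asboolP/hasP => [[e' o /mapP[s ps eE]]|[s ps /asboolP o]].
    by exists s => //; apply/asboolP; rewrite -eE.
  by exists (f s) => //; apply: map_f.
rewrite /q_exponent /crosses_black_left /crosses_black_right !meetsE.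
case: hasP => [[s ps /asboolP o]|_]; case: hasP => // -[s' ps' /asboolP o'].
have [v Lv [El Er]] := orbit_trans o o'.
have := left_diff s; rewrite El Er /= diffE -opprB left_diff -dvec_opp.
have /= := allP dirp _ ps; have /= := allP dirp _ ps'.
by move=> + + /dvec_inj; case: (s.2); case: (s'.2).
Qed.

End Crossings.

Section Paths.

Variables (L : set pointZ) (x0 x1 y1 : nat).
Hypotheses (hL : valid_lattice L) (hb : lattice_basis L x0 x1 y1).

Lemma simple_path0 : simple_path L (path0 x0).
Proof.
have [[x0p _] _ [y1p _] _ _] := hb.
split; first by rewrite map_inj_uniq ?iota_uniq// => i j [].
  by apply/allP => _ /mapP[i _ ->].
move=> _ _ /mapP[i + ->] /mapP[j + ->] _; rewrite !mem_iota !add0n /= => ix jx.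
move=> /(small_lattice hL hb) /= H; suff -> : i = j by [].
have : ((i%:Z, 0) - (j%:Z, 0) : pointZ) = 0 by apply: H; lia.
by case; lia.
Qed.

Lemma simple_path1 : simple_path L (path1 x1 y1).
Proof.
have [[x0p _] _ [y1p _] _ [x10 _]] := hb.
split.
- rewrite cat_uniq !map_inj_uniq ?iota_uniq; [|by move=> i j []..].
  rewrite andbT /=; apply/hasPn => _ /mapP[i _ ->].
  by apply/negP => /mapP[].
- by rewrite all_cat; apply/andP; split; apply/allP => _ /mapP[i _ ->].
- move=> s s'; rewrite !mem_cat.
  move=> /orP[]/mapP[i + ->] /orP[]/mapP[j + ->] //= _; rewrite !mem_iota !add0n /=;
    move=> ix jx /(small_lattice hL hb) /= H; suff -> : i = j by [].
  + have : ((0, i%:Z) - (0, j%:Z) : pointZ) = 0 by apply: H; lia.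
    by case; lia.
  + have : ((i%:Z, y1%:Z) - (j%:Z, y1%:Z) : pointZ) = 0 by apply: H; lia.
    by case; lia.
Qed.

End Paths.

(** * Matchings of the torus *)

Section Cells.

Variables (L : set pointZ) (m : nat) (b w : 'I_m -> pointZ).
Hypotheses (hL : valid_lattice L).
Hypotheses (b_black : forall i, black (b i)) (w_white : forall i, ~~ black (w i)).
Hypothesis b_inj : forall i j, L (b i - b j) -> i = j.
Hypothesis w_inj : forall i j, L (w i - w j) -> i = j.
Hypothesis b_cover : forall p, black p -> exists i, L (p - b i).
Hypothesis w_cover : forall p, ~~ black p -> exists i, L (p - w i).

Let L0 : L 0. Proof. by have [] := valid_subgroup hL. Qed.
Let LD u v : L u -> L v -> L (u + v). Proof. by have [_ + _] := valid_subgroup hL; apply. Qed.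
Let LN u : L u -> L (- u). Proof. by have [_ _] := valid_subgroup hL; apply. Qed.

Lemma lattice_swap (p q : pointZ) : L (p - q) -> L (q - p).
Proof. by rewrite -opprB => /LN; rewrite opprK. Qed.

Lemma lattice_trans (p q r : pointZ) : L (p - q) -> L (q - r) -> L (p - r).
Proof. by move=> /LD H /H; rewrite addrA subrK. Qed.

Lemma lattice_black p q : L (p - q) -> black p = black q.
Proof. by move=> Lpq; rewrite -(subrK q p) addrC (black_lattice _ hL). Qed.

Lemma lattice_shift (p q v : pointZ) : L (p - q) -> L (p + v - (q + v)).
Proof. by rewrite opprD addrACA subrr addr0. Qed.

Lemma periodicE dl p q : periodic L dl -> L (p - q) -> dl p = dl q.
Proof. by move=> per Lpq; rewrite -(subrK q p) addrC per. Qed.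

(** Index of a nonzero term of the fully expanded determinant. The direction is recorded because
    several orbits may join the same two squares of the torus. *)
Definition config (sg : {perm 'I_m} * {ffun 'I_m -> direction}) : bool :=
  [forall i, `[< L (b i + dvec (sg.2 i) - w (sg.1 i)) >] ].

Lemma configP (sg : {perm 'I_m} * {ffun 'I_m -> direction}) :
  reflect (forall i, L (b i + dvec (sg.2 i) - w (sg.1 i))) (config sg).
Proof. by apply: (iffP forallP) => H i; apply/asboolP. Qed.

Lemma config_field sg : config sg -> exists dl,
  [/\ domino_field dl, periodic L dl & forall i, dl (b i) = sg.2 i].
Proof.
case: sg => s g /configP /= sgP.
have cell p : exists k, L (p - (if black p then b k else w k)).
  by case pb : (black p); [exact: b_cover|apply: w_cover; rewrite pb].
have [idx idxP] := choice cell.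
have idxb p i : L (p - b i) -> idx p = i.
  move=> Lp; have := idxP p; rewrite (lattice_black Lp) b_black => Lq.
  by apply/esym/b_inj; apply: lattice_trans Lq; exact: lattice_swap.
have idxw p i : L (p - w i) -> idx p = i.
  move=> Lp; have := idxP p; rewrite (lattice_black Lp) (negPf (w_white i)) => Lq.
  by apply/esym/w_inj; apply: lattice_trans Lq; exact: lattice_swap.
(* A white square points back to the black square that [s] matches with it. *)
pose dl p := if black p then g (idx p) else dopp (g ((s^-1)%g (idx p))).
exists dl; split.
- move=> p; rewrite {1 3}/dl; have := idxP p; case: ifP => pb Lp.
    rewrite /dl pb /= black_dvec pb /= (idxw _ (s (idx p))) ?permK//.
    by apply: lattice_trans (sgP (idx p)); apply: lattice_shift.
  set k := (s^-1)%g (idx p).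
  rewrite /dl pb black_dvec pb /= -/k (idxb _ k) ?doppK//.
  have : L (b k + dvec (g k) - w (idx p)) by have := sgP k; rewrite /k permKV.
  move=> /lattice_swap/(lattice_trans Lp)/(lattice_shift (- dvec (g k))).
  by rewrite addrK dvec_opp.
- move=> v Lv p.
  have idxv : idx (p + v) = idx p.
    have := idxP p; case: ifP => pb Lp; [apply: idxb|apply: idxw];
      by rewrite addrAC; apply: LD.
  by rewrite /dl (black_lattice _ hL)// idxv.
- by move=> i; rewrite /dl b_black (idxb _ i)// subrr.
Qed.

(** Two black squares sent to the same white class have the same direction, read off at the white
    end, and are therefore equivalent. *)
Lemma field_config dl : domino_field dl -> periodic L dl ->
  exists s, config (s, [ffun i => dl (b i)]).
Proof.
move=> dlP per.
have sP i : exists j, L (b i + dvec (dl (b i)) - w j).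
  by apply: w_cover; rewrite black_dvec b_black.
have [s {}sP] := choice sP.
have s_inj : injective s.
  move=> i j sij; have := sP j; rewrite -sij => /lattice_swap/(lattice_trans (sP i)).
  set u := b i + _; set v := b j + _ => Luv.
  have dE : dl (b i) = dl (b j).
    by apply: (can_inj doppK); rewrite -!dlP; exact: periodicE.
  apply: b_inj; move: Luv; rewrite /u /v dE => /(lattice_shift (- dvec (dl (b j)))).
  by rewrite !addrK.
by exists (perm s_inj); apply/configP => i; rewrite /= permE ffunE.
Qed.

Lemma config_perm_uniq s s' g : config (s, g) -> config (s', g) -> s = s'.
Proof.
move=> /configP H /configP H'; apply/permP => i; apply: w_inj.
exact: lattice_trans (lattice_swap (H i)) (H' i).
Qed.

Lemma field_tiling_inj dl dl' p : black p ->
  field_tiling dl = field_tiling dl' -> dl p = dl' p.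
Proof.
move=> pb E; have : field_tiling dl (p, p + dvec (dl p)) by [].
by rewrite E => -[_ /= /addrI/dvec_inj].
Qed.

Lemma field_tiling_eq dl dl' : periodic L dl -> periodic L dl' ->
  (forall i, dl (b i) = dl' (b i)) -> field_tiling dl = field_tiling dl'.
Proof.
move=> per per' E; have {}E p : black p -> dl p = dl' p.
  by move=> /b_cover[i Li]; rewrite (periodicE per Li) E -(periodicE per' Li).
by apply/seteqP; split=> -[p q] [/= pb ->]; split=> //=; rewrite E.
Qed.

Lemma exists_east : exists s0 : {perm 'I_m}, forall i, L (b i + dvec East - w (s0 i)).
Proof.
pose dl p := if black p then East else West.
have dlP : domino_field dl.
  by move=> p; rewrite /dl black_dvec; case: (black p).
have per : periodic L dl by move=> v Lv p; rewrite /dl (black_lattice _ hL).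
have [s /configP H] := field_config dlP per; exists s => i.
by have := H i; rewrite /= ffunE /dl b_black.
Qed.

Definition config_sign (sg : {perm 'I_m} * {ffun 'I_m -> direction}) : int :=
  (-1) ^+ sg.1 * \prod_i (if sg.2 i == East then -1 else 1).

(* Composing with the inverse of the brick wall matching turns the matching
   into a permutation whose fixed points carry the negative edges, so that the
   signs combine into the parity of the number of nontrivial cycles. *)
Lemma config_signE (s0 : {perm 'I_m}) (H0 : forall i, L (b i + dvec East - w (s0 i))) sg dl :
  config sg -> (forall i, dl (b i) = sg.2 i) ->
  exists2 pi : {perm 'I_m}, follows L b dl pi &
    config_sign sg = (-1) ^+ (odd_perm s0 + m + #|porbit pi @: moving b dl|)%N.
Proof.
case: sg => s g /configP sgP /= dlg; pose pi := (s * s0^-1)%g.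
have fol : follows L b dl pi.
  move=> i; rewrite permM /next dlg.
  have := H0 ((s0^-1)%g (s i)); rewrite permKV => /lattice_swap.
  move=> /(lattice_trans (sgP i)) /(lattice_shift (- dvec East)).
  by rewrite addrK.
exists pi => //.
have sE : s = (pi * s0)%g by rewrite mulgKV.
have prodE : \prod_i (if g i == East then -1 else 1) =
    (-1) ^+ #|(~: moving b dl)%SET| :> int.
  rewrite -big_mkcond /= prodr_const; congr (_ ^+ _); apply: eq_card => i.
  by rewrite !inE negbK dlg.
rewrite /config_sign /= prodE sE odd_permM signr_addb.
rewrite [in X in X * _ * _]/odd_perm signr_addb !signr_odd card_ord.
rewrite (card_porbits_fixed b_inj fol) !exprD.
(* The fixed squares count twice, as negative edges and as cycles of [pi], and their sign
   cancels. *)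
set c := (-1) ^+ #|(~: _)%SET|; have cc : c * c = 1 by rewrite -expr2 sqrr_sign.
rewrite -[RHS]mulr1 -[X in _ = _ * X]cc; move: c {cc} => c.
by move: ((-1) ^+ m) ((-1) ^+ s0) ((-1) ^+ #|_|) => x y z; ring.
Qed.

(** Both signs refer to the same [s0], so only the numbers of moving cycles matter; these bound each
    other. *)
Lemma config_sign_const sg dl F sg' dl' F' :
  config sg -> (forall i, dl (b i) = sg.2 i) ->
  domino_field dl -> periodic L dl -> is_potential dl F ->
  config sg' -> (forall i, dl' (b i) = sg'.2 i) ->
  domino_field dl' -> periodic L dl' -> is_potential dl' F' ->
  (forall v, L v -> F v = F' v) -> (exists Y : nat, (0 < Y)%N /\ L (0, Y%:Z)) ->
  config_sign sg = config_sign sg'.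
Proof.
move=> sgP dlg dlP per FP sgP' dlg' dlP' per' FP' FF' Y.
have [s0 H0] := exists_east.
have [pi fol ->] := config_signE H0 sgP dlg.
have [pi' fol' ->] := config_signE H0 sgP' dlg'.
congr (_ ^+ (_ + _)%N); apply/eqP; rewrite eqn_leq.
have FF v : L v -> F' v = F v by move=> /FF'.
rewrite (leq_moving_orbits hL b_black b_inj b_cover dlP per FP fol dlP' per' FP' fol')//.
by rewrite (leq_moving_orbits hL b_black b_inj b_cover dlP' per' FP' fol' dlP per FP fol).
Qed.

(** Only the index of the class of [p] can contribute. *)
Lemma config_crossing (g : 'I_m -> direction) dl p d :
  (forall i, dl (b i) = g i) -> periodic L dl ->
  \sum_i (`[< Defs.orbit L (b i, b i + dvec (g i)) (p, p + dvec d) >] : nat)%:Z =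
  (black p && (dl p == d) : nat)%:Z.
Proof.
move=> dlg per.
have orbE i : `[< Defs.orbit L (b i, b i + dvec (g i)) (p, p + dvec d) >] =
    `[< L (p - b i) >] && (g i == d).
  apply/asboolP/andP => [[v Lv vE]|[/asboolP Lp /eqP <-]].
    have pE : p = b i + v := congr1 fst vE.
    have qE : p + dvec d = b i + dvec (g i) + v := congr1 snd vE.
    split; first by apply/asboolP; rewrite pE addrAC subrr add0r.
    by apply/eqP; move: qE; rewrite pE addrAC => /addIr/addrI/dvec_inj.
  exists (p - b i) => //; congr (_, _); rewrite /=; first by rewrite addrC subrK.
  by rewrite addrAC (addrC (b i)) subrK.
case pb : (black p) => /=; last first.
  rewrite big1// => i _; rewrite orbE; case: asboolP => //= /lattice_black.
  by rewrite pb b_black.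
have [i Li] := b_cover pb.
rewrite (bigD1 i)//= big1 ?addr0 => [|j ji]; rewrite orbE.
  by rewrite asboolT// (periodicE per Li) dlg.
case: asboolP => //= Lj; case/eqP: ji; apply: b_inj.
exact: lattice_trans (lattice_swap Lj) Li.
Qed.

(** Exchanging the sums turns the exponent of a term into the signed crossings of its tiling, which
    the potential computes. *)
Lemma config_exponent p (g : 'I_m -> direction) dl :
  simple_path L p -> (forall i, dl (b i) = g i) -> periodic L dl ->
  \sum_i q_exponent p (Defs.orbit L (b i, b i + dvec (g i))) =
  \sum_(s <- p) cross dl s.
Proof.
move=> simp dlg per; under eq_bigr do rewrite (q_exponentE _ _ simp)//.
rewrite exchange_big; apply: eq_bigr => s _; rewrite sumrB.
have rl : left_square s = right_square s + dvec (drot s.2).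
  by case: (s) => u d; rewrite left_squareE.
have lr : right_square s = left_square s + dvec (dopp (drot s.2)).
  by rewrite rl dvec_opp addrK.
rewrite /cross -(config_crossing _ _ dlg per) -(config_crossing _ _ dlg per).
by rewrite -lr -rl.
Qed.

End Cells.

(** * Expansion of the determinant *)

Lemma prod_monomial (I : Type) (r : seq I) (c : I -> int) (k : I -> int * int) :
  \prod_(i <- r) (<< c i *g k i >> : laurent) =
  << \prod_(i <- r) c i *g \sum_(i <- r) k i >>.
Proof.
elim: r => [|i r IH]; first by rewrite !big_nil.
by rewrite !big_cons IH -[LHS]/(lmul _ _) lmulUU.
Qed.

Lemma coef_sum (I : Type) (r : seq I) (P : pred I) (G : I -> laurent) k :
  (\sum_(i <- r | P i) G i)@_k = \sum_(i <- r | P i) (G i)@_k.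
Proof.
apply: (big_morph (fun p : laurent => p@_k)) => [p q|]; first exact: mcoeffD.
exact: mcoeff0.
Qed.

Lemma coef_sign (n : bool) (p : laurent) k : ((-1) ^+ n * p)@_k = (-1) ^+ n * p@_k.
Proof.
by case: n; rewrite ?mul1r// expr1 !mulN1r; exact: mcoeffN.
Qed.

Lemma sum_pair (I : Type) (r : seq I) (f g : I -> int) :
  \sum_(i <- r) (f i, g i) = (\sum_(i <- r) f i, \sum_(i <- r) g i) :> (int * int)%type.
Proof.
elim: r => [|i r IH]; first by rewrite !big_nil.
by rewrite !big_cons IH.
Qed.

Section Determinant.

Variables (L : set pointZ) (x0 x1 y1 m : nat) (b w : 'I_m -> pointZ).
Hypotheses (hL : valid_lattice L).
Hypotheses (b_black : forall i, black (b i)).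

(** Each orbit has a representative starting at [b i] itself, given by its direction. *)
Lemma joining_orbitsE i j :
  joining_orbits L (b i) (w j) =
  (fun d => Defs.orbit L (b i, b i + dvec d)) @` [set d | L (b i + dvec d - w j)].
Proof.
have [L0 LD LN] := valid_subgroup hL.
apply/seteqP; split=> [o [e [/and3P[eb ew es] [v Lv e1] [v' Lv' e2] ->]]|o [d Ld <-]].
  have [d dE] := share_sideP es.
  have e2' : e.2 = b i + dvec d + v by rewrite dE e1 addrAC.
  have wE : b i + dvec d - w j = v' - v.
    apply/eqP; rewrite subr_eq addrAC -subr_eq opprK; apply/eqP.
    by rewrite -e2' e2 addrC.
  exists d; first by rewrite /= wE; apply: LD => //; apply: LN.
  apply/seteqP; split=> [_ [u Lu ->]|_ [u Lu ->]].
    exists (u - v); first by apply: LD => //; apply: LN.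
    by congr (_, _); rewrite /= ?e1 ?e2' -[RHS]addrA [v + _]addrC subrK.
  exists (v + u); first by apply: LD.
  by congr (_, _); rewrite /= ?e1 ?e2' [RHS]addrA.
exists (b i, b i + dvec d); split=> //.
- by rewrite /is_edge /= black_dvec b_black share_side_dvec.
- by exists 0 => //; rewrite addr0.
- by exists (b i + dvec d - w j) => //; rewrite [RHS]addrC subrK.
Qed.

(** A translation fixing [b i] is zero, so directions give distinct orbits even on a small torus. *)
Lemma orbit_dir_inj i : injective (fun d => Defs.orbit L (b i, b i + dvec d)).
Proof.
have [L0 _ _] := valid_subgroup hL.
move=> d d' E; have : Defs.orbit L (b i, b i + dvec d) (b i, b i + dvec d).
  by exists 0 => //; congr (_, _); rewrite /= addr0.
rewrite E => -[v Lv vE].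
have v0 : b i = b i + v := congr1 fst vE.
have qE : b i + dvec d = b i + dvec d' + v := congr1 snd vE.
by move: qE; rewrite addrAC -v0 => /addrI/dvec_inj.
Qed.

Definition dir_weight i d : laurent :=
  orbit_weight x0 x1 y1 (Defs.orbit L (b i, b i + dvec d)).

Lemma kasteleynE i j : kasteleyn L x0 x1 y1 b w i j =
  \sum_(d | `[< L (b i + dvec d - w j) >]) dir_weight i d.
Proof.
rewrite mxE joining_orbitsE fsbig_image; last first.
  by move=> d d' _ _; exact: orbit_dir_inj.
rewrite -[RHS]big_filter [RHS]fsbig_seq ?filter_uniq ?index_enum_uniq//.
suff -> : [set d | L (b i + dvec d - w j)] =
    [set` [seq d <- index_enum direction | `[< L (b i + dvec d - w j) >] ] ] by [].
apply/seteqP; split=> d; rewrite /= mem_filter mem_index_enum andbT.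
  by move=> ?; apply/asboolP.
by move/asboolP.
Qed.

Lemma dir_weightE i d : dir_weight i d =
  << (if d == East then -1 else 1) *g
     (q_exponent (path0 x0) (Defs.orbit L (b i, b i + dvec d)),
      q_exponent (path1 x1 y1) (Defs.orbit L (b i, b i + dvec d))) >>.
Proof.
have [L0 _ _] := valid_subgroup hL.
rewrite /dir_weight /orbit_weight; congr << _ *g _ >>; rewrite /orbit_sign.
congr (if _ then _ else _); apply/asboolP/eqP => [[_ [v Lv ->]]|->].
  move=> /eqP E; have {}E : b i + dvec d + v = b i + v + dvec East := E.
  by move: E; rewrite addrAC => /addrI/dvec_inj.
exists (b i, b i + dvec East); last by rewrite /negative_edge.
by exists 0 => //; congr (_, _); rewrite /= addr0.
Qed.

Definition exponents (p : seq (pointZ * direction)) (g : 'I_m -> direction) : int :=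
  \sum_i q_exponent p (Defs.orbit L (b i, b i + dvec (g i))).

(** Leibniz formula, each product of entries being expanded over the choices of directions. *)
Lemma coef_det k l : (\det (kasteleyn L x0 x1 y1 b w))@_(k, l) =
  \sum_(sg | config L b w sg && (exponents (path0 x0) sg.2 == k) &&
              (exponents (path1 x1 y1) sg.2 == l)) config_sign sg.
Proof.
pose Q (s : {perm 'I_m}) i d := `[< L (b i + dvec d - w (s i)) >].
have coef_prod (g : {ffun 'I_m -> direction}) : (\prod_i dir_weight i (g i))@_(k, l) =
    if (exponents (path0 x0) g == k) && (exponents (path1 x1 y1) g == l)
    then \prod_i (if g i == East then -1 else 1) else 0.
  rewrite (eq_bigr _ (fun i _ => dir_weightE i (g i))) prod_monomial sum_pair mcoeffU.
  by rewrite -pair_eqE /= /exponents; case: (_ && _).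
transitivity (\sum_(s : {perm 'I_m}) \sum_(g in family (Q s))
    (-1) ^+ s * (\prod_i dir_weight i (g i))@_(k, l)).
  rewrite /determinant coef_sum; apply: eq_bigr => s _; rewrite coef_sign.
  rewrite (eq_bigr _ (fun i _ => kasteleynE i (s i))) (bigA_distr_big_dep (Q s)).
  by rewrite coef_sum mulr_sumr.
rewrite pair_big_dep /= big_mkcond [RHS]big_mkcond; apply: eq_bigr => -[s g] _ /=.
rewrite coef_prod /config_sign /= -andbA.
have -> : (g \in family (Q s)) = config L b w (s, g) by apply: eq_forallb.
by case: ifP => // _; case: ifP; rewrite ?mulr0.
Qed.

End Determinant.

(** * Counting the tilings of a given flux *)

Theorem proposition7p0p2 (R : realType) (L : set pointZ) (hL : valid_lattice L)
    (x0 x1 y1 : nat) (hbasis : lattice_basis L x0 x1 y1)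
    (m : nat) (b w : 'I_m -> pointZ)
    (hb : set_bij [set: 'I_m]
            [set s | domain_squares x0 y1 s /\ black s] b)
    (hw : set_bij [set: 'I_m]
            [set s | domain_squares x0 y1 s /\ ~~ black s] w)
    (phi : R * R) (hphi : fluxes L phi)
    (i j : int) (hij : corresponds x0 x1 y1 phi i j) :
  ([set t | torus_tiling L t /\ is_flux L t phi]
    #= `I_(`|(\det (kasteleyn L x0 x1 y1 b w))@_(i, j)|%N))%card.
Proof.
have [L0 LD LN] := valid_subgroup hL.
have bD k : domain_squares x0 y1 (b k) /\ black (b k) by case: hb => H _ _; apply: H.
have wD k : domain_squares x0 y1 (w k) /\ ~~ black (w k) by case: hw => H _ _; apply: H.
have b_black k : black (b k) by case: (bD k).
have w_white k : ~~ black (w k) by case: (wD k).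
have b_inj k k' : L (b k - b k') -> k = k'.
  move=> H; case: hb => _ inj _; apply: inj; rewrite ?inE//.
  by apply: (domain_inj hL hbasis) H; [case: (bD k)|case: (bD k')].
have w_inj k k' : L (w k - w k') -> k = k'.
  move=> H; case: hw => _ inj _; apply: inj; rewrite ?inE//.
  by apply: (domain_inj hL hbasis) H; [case: (wD k)|case: (wD k')].
have b_cover p : black p -> exists k, L (p - b k).
  move=> pb; have [s sD Ls] := domain_cover hL hbasis p.
  case: hb => _ _ /(_ s)[|k _ sE]; last by exists k; rewrite sE.
  by split=> //; rewrite -(lattice_black hL Ls).
have w_cover p : ~~ black p -> exists k, L (p - w k).
  move=> pb; have [s sD Ls] := domain_cover hL hbasis p.
  case: hw => _ _ /(_ s)[|k _ sE]; last by exists k; rewrite sE.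
  by split=> //; rewrite -(lattice_black hL Ls).
(* The terms of the expansion that contribute to the given monomial. *)
pose good (sg : {perm 'I_m} * {ffun 'I_m -> direction}) := config L b w sg &&
  (exponents L b (path0 x0) sg.2 == i) && (exponents L b (path1 x1 y1) sg.2 == j).
have good_flux (sg : {perm 'I_m} * {ffun 'I_m -> direction}) dl : domino_field dl -> periodic L dl ->
    (forall k, dl (b k) = sg.2 k) -> config L b w sg ->
    good sg <-> is_flux L (field_tiling dl) phi.
  move=> dlP per dlg cf; have [F FP] := potential_field dlP.
  rewrite (flux_corresponds hL hbasis dlP per FP hij) /good cf /=.
  rewrite /exponents (config_exponent hL b_black b_inj b_cover (simple_path0 hL hbasis) dlg per).
  rewrite (config_exponent hL b_black b_inj b_cover (simple_path1 hL hbasis) dlg per).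
  rewrite (cross_path0 _ dlP FP) (cross_path1 _ _ dlP FP).
  by split=> [/andP[/eqP-> /eqP->]|[-> ->]]; rewrite ?eqxx.
(* Off [good] a constant field serves as a default, so that [choice] applies. *)
have good_field (sg : {perm 'I_m} * {ffun 'I_m -> direction}) : exists dl, good sg ->
    [/\ domino_field dl, periodic L dl & forall k, dl (b k) = sg.2 k].
  case: (boolP (good sg)) => [|_]; last by exists (fun=> East).
  rewrite /good => /andP[/andP[cf _] _].
  by have [dl H] := config_field hL b_black w_white b_inj w_inj b_cover w_cover cf; exists dl.
have [D DP] := choice good_field.
have tilingsE : [set t | torus_tiling L t /\ is_flux L t phi] =
    (fun sg => field_tiling (D sg)) @` [set sg | good sg].
  apply/seteqP; split=> [t [/torus_field[dl [dlP per ->]] fl]|_ [sg gsg <-]].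
    have [s cf] := field_config hL b_black b_inj w_cover dlP per.
    have gs : good (s, [ffun k => dl (b k)]).
      by apply/(good_flux _ dl) => // k; rewrite ffunE.
    have [_ perD DE] := DP _ gs.
    exists (s, [ffun k => dl (b k)]) => //.
    by apply: (field_tiling_eq b_cover perD per) => k; rewrite DE ffunE.
  have [dlP per DE] := DP _ gsg; split; first exact: field_torus.
  by apply/(good_flux sg) => //; case/andP: gsg => /andP[].
(* The tiling determines the directions at the [b k], and these determine the permutation. *)
have D_inj : {in [set sg | good sg] &, injective (fun sg => field_tiling (D sg))}.
  move=> [s g] [s' g']; rewrite !inE => gs gs' E.
  have [_ _ DE] := DP _ gs; have [_ _ DE'] := DP _ gs'.
  have gg' : g = g'.
    by apply/ffunP => k; rewrite -(DE k) -(DE' k); exact: field_tiling_inj E.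
  move: gs gs'; rewrite -gg' => /andP[/andP[c _] _] /andP[/andP[c' _] _].
  by rewrite (config_perm_uniq hL w_inj c c').
have good_card : ([set sg | good sg] #= `I_#|good|)%card.
  pose f n := nth (1%g, [ffun=> East]) (enum good) n.
  have -> : [set sg | good sg] = f @` `I_#|good|.
    apply/seteqP; split=> [sg gsg|_ [n /= ltn <-]].
      exists (index sg (enum good)); last by rewrite /f nth_index// mem_enum.
      by rewrite /= cardE index_mem mem_enum.
    have : f n \in enum good by rewrite mem_nth// -cardE.
    by rewrite mem_enum.
  apply: inj_card_eq => k k'; rewrite !inE /= => lt lt' /eqP.
  by rewrite nth_uniq ?enum_uniq -?cardE// => /eqP.
rewrite tilingsE; apply: card_eq_trans (inj_card_eq D_inj) _.
suff -> : `|(\det (kasteleyn L x0 x1 y1 b w))@_(i, j)|%N = #|good| by [].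
rewrite (coef_det _ _ _ w hL b_black).
case: (pickP good) => [sg0 g0|none]; last first.
  by rewrite big_pred0// (eq_card0 none).
have sign_eq sg : good sg -> config_sign sg = config_sign sg0.
  move=> gsg; have [dlP per DE] := DP _ gsg; have [dlP0 per0 DE0] := DP _ g0.
  have [F FP] := potential_field dlP; have [F0 FP0] := potential_field dlP0.
  have cf : config L b w sg by case/andP: gsg => /andP[].
  have cf0 : config L b w sg0 by case/andP: g0 => /andP[].
  apply: (config_sign_const hL b_black b_inj b_cover w_cover cf DE dlP per FP
    cf0 DE0 dlP0 per0 FP0).
    (* Equal fluxes force equal periods of the two potentials. *)
    move=> v Lv; apply/eqP; rewrite -(eqr_int R); apply/eqP.
    have /(flux_potential hL dlP per FP)/(_ v Lv) := (good_flux sg _ dlP per DE cf).1 gsg.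
    have /(flux_potential hL dlP0 per0 FP0)/(_ v Lv) := (good_flux sg0 _ dlP0 per0 DE0 cf0).1 g0.
    by move=> ->; lra.
  have [[x0p Lx0] _ [y1p _] _ [_ Lx1]] := hbasis.
  (* The vertical period is x0 v_1 - x1 v_0. *)
  exists (x0 * y1)%N; split; first by rewrite muln_gt0 x0p.
  have := LD _ _ (subgroup_mulz x0%:Z (valid_subgroup hL) Lx1)
    (subgroup_mulz (- x1%:Z) (valid_subgroup hL) Lx0).
  rewrite !mulz_pair /=; congr (L _); congr (_, _); rewrite /=; lia.
(* The coefficient is now the number of terms times a common sign. *)
rewrite (eq_bigr _ sign_eq) sumr_const -mulr_natr abszM.
have [s0 H0] := exists_east hL b_black b_inj w_cover.
have [_ _ DE0] := DP _ g0.
have cf0 : config L b w sg0 by case/andP: g0 => /andP[].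
have [pi _ ->] := config_signE hL b_inj H0 cf0 DE0.
by rewrite abszX exp1n mul1n natz absz_nat.
Qed.
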